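(* Let $u\in C^2\left(\overline{\mathbb{R}^{N+1}_+}\right)$ be a real-valued solution of $\mathcal Lu=0$ in $\mathbb{R}^{N+1}_+$ satisfying the Neumann boundary condition $\lim_{y\to 0^+}y^cD_yu(x,y)=0$ for all $x\in\mathbb{R}^N$. If $u$ is bounded from below or from above, then $u$ is constant.
   Context: $N\ge 0$ is an integer, $\mathbb{R}^{N+1}_+=\{z=(x,y):x\in\mathbb{R}^N,\ y>0\}$ and $\overline{\mathbb{R}^{N+1}_+}=\{y\ge 0\}$. Let $c\in\mathbb{R}$ with $c+1>0$ and $a\in\mathbb{R}^N$ with $|a|<1$, and set $$\mathcal L=\Delta_x+2a\cdot\nabla_xD_y+D_{yy}+\frac{c}{y}D_y .$$ $C^2(\overline{\mathbb{R}^{N+1}_+})$ is the set of functions whose derivatives up to order two exist and are continuous up to $y=0$. *)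

(* Defs.v *)
From mathcomp Require Import all_boot all_order all_algebra.
From mathcomp Require Import all_classical all_reals all_analysis.

Set Implicit Arguments.
Unset Strict Implicit.
Unset Printing Implicit Defensive.

Import Order.TTheory GRing.Theory Num.Theory.
Import numFieldNormedType.Exports.

Local Open Scope classical_set_scope.
Local Open Scope ring_scope.

Definition half_space (R : realType) (N : nat) : set ('rV[R]_N * R) :=
  [set z | 0 < z.2].
Arguments half_space R N _ : clear implicits.

Definition closed_half_space (R : realType) (N : nat) : set ('rV[R]_N * R) :=
  [set z | 0 <= z.2].
Arguments closed_half_space R N _ : clear implicits.

(* The library norm on ['rV[R]_N] is the sup norm, hence this definition. *)
Definition euclidean_norm (R : realType) (N : nat) (a : 'rV[R]_N) : R :=
  Num.sqrt (\sum_(i < N) a ord0 i ^+ 2).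

(* Standard basis of R^N x R: [Some i] is the direction x_i, [None] is y. *)
Definition basis_vec (R : realType) (N : nat) (k : option 'I_N) :
    'rV[R]_N * R :=
  if k is Some i then (delta_mx ord0 i, 0) else (0, 1).

Definition partial (R : realType) (N : nat) (k : option 'I_N)
    (u : 'rV[R]_N * R -> R) (z : 'rV[R]_N * R) : R :=
  'D_(basis_vec R k) u z.

(* A function on the open half-space, here totalized by arbitrary values
   elsewhere, is continuous up to y = 0 when it extends to a continuous
   function on the closed half-space. *)
Definition continuous_up_to_boundary (R : realType) (N : nat)
    (g : 'rV[R]_N * R -> R) : Prop :=
  exists2 h : 'rV[R]_N * R -> R,
    {within closed_half_space R N, continuous h} &
    forall z, half_space R N z -> h z = g z.

(* [u] stands for a function on the closed half-space; its values at y < 0 are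
   irrelevant. Partial derivatives are only taken at y > 0. *)
Definition C2_closed_half_space (R : realType) (N : nat)
    (u : 'rV[R]_N * R -> R) : Prop :=
  [/\ {within closed_half_space R N, continuous u},
      forall k : option 'I_N,
        (forall z, half_space R N z -> derivable u z (basis_vec R k)) /\
        continuous_up_to_boundary (partial k u) &
      forall k l : option 'I_N,
        (forall z, half_space R N z ->
           derivable (partial k u) z (basis_vec R l)) /\
        continuous_up_to_boundary (partial l (partial k u))].

Definition operator_L (R : realType) (N : nat) (c : R) (a : 'rV[R]_N)
    (u : 'rV[R]_N * R -> R) (z : 'rV[R]_N * R) : R :=
  \sum_(i < N) partial (Some i) (partial (Some i) u) z
  + 2 * (\sum_(i < N) a ord0 i * partial (Some i) (partial None u) z)
  + partial None (partial None u) z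
  + c / z.2 * partial None u z.

(* Main.v *)
(* The proof is a Harnack inequality u(z) <= C u(z0), uniform over nonnegative
   solutions and all points of the closed half-space; applied to u - inf u
   (or to -u) it gives the theorem. Everything is done with the maximum
   principle, so that C^2 solutions suffice:
   - solutions enter only through second-order expansions along the fixed
     directions e_i, e_i + b_i e_y and e_y, whose squares with positive weights
     make up the principal part; this class is invariant under horizontal
     translations and dilations;
   - explicit barriers (powers of polynomials in x and y^2) propagate lower
     bounds from a box to a box five times larger, hence with polynomial loss to
     all distances, and propagate a large value near y = 0 up to a point at a
     definite height;
   - a coupling of two points reflected in a horizontal direction gives a
     horizontal Lipschitz bound, hence the persistence on a horizontal disc of
     a value comparable to the maximum on a surrounding box;
   - at a maximum of u d^q, d being the distance to the boundary of a box,
     u at most doubles on a ball of radius comparable to d; spreading the value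
     there to z0 bounds u d^q by a multiple of u(z0). *)
Require Import Defs.
From mathcomp Require Import all_boot all_order all_algebra.
From mathcomp Require Import all_classical all_reals all_analysis.
From mathcomp Require Import ring lra.

Import Order.TTheory GRing.Theory Num.Theory.
Import numFieldNormedType.Exports.

Local Open Scope classical_set_scope.
Local Open Scope ring_scope.

Set Implicit Arguments.
Unset Strict Implicit.
Unset Printing Implicit Defensive.

(** * Second-order expansions *)

(** The two hypotheses on the coefficients have precise roles. Because |a| < 1, one can take 0 < k <
    1 - |a|^2, put b = a / (1 - k) and write the principal part as k sum_i D_{e_i}^2 + (1 - k) sum_i
    D_{e_i + b_i e_y}^2 + (1 - |a|^2 / (1 - k)) D_yy, all weights being positive. Tests at an
    extremum then only require expansions along lines; k > 0 keeps the pure directions e_i available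
    for the coupling. Because c + 1 > 0, L(y^2) = 2 (c + 1) is positive, so barriers even in y are
    under control down to y = 0, and p = 1 - min(c, 0) is below 2. At y = 0 the boundary condition
    is used in the integrated form u(x, y) - u(x, 0) = o(y^p): a positive multiple of y^p beats both
    this error and the O(y^2) variation of an even barrier. As u is merely C^2, the equation cannot
    be differentiated to estimate derivatives; the coupling compares values only and takes the place
    of a gradient estimate. *)

Definition jet2 (R : realType) (f : R -> R) (a b c : R) : Prop :=
  exists2 r : R -> R, r t @[t --> 0] --> 0 &
    forall t, f t = a + b * t + (c / 2 + r t) * t ^+ 2.

Section Jet2.
Context {R : realType}.
Implicit Types (f g : R -> R) (a b c k t e : R).

Lemma jet2_ext f g a b c : f =1 g -> jet2 f a b c -> jet2 g a b c.
Proof. by move=> fg [r r0 fE]; exists r => // t; rewrite -fg. Qed.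

Lemma jet2_eq f a b c a' b' c' :
  jet2 f a b c -> a = a' -> b = b' -> c = c' -> jet2 f a' b' c'.
Proof. by move=> ? <- <- <-. Qed.

Lemma jet2_cst k : jet2 (fun=> k) k 0 0.
Proof.
by exists (fun=> 0) => [|t]; [exact: cvg_cst|rewrite !mul0r !addr0 mul0r addr0].
Qed.

Lemma jet2_affine a b : jet2 (fun t => a + b * t) a b 0.
Proof.
by exists (fun=> 0) => [|t]; [exact: cvg_cst|rewrite !mul0r !addr0 mul0r addr0].
Qed.

Lemma jet2D {f g a b c} {a' b' c' : R} : jet2 f a b c -> jet2 g a' b' c' ->
  jet2 (fun t => f t + g t) (a + a') (b + b') (c + c').
Proof.
move=> [r r0 fE] [s s0 gE]; exists (fun t => r t + s t).
  by rewrite -[X in _ --> X](addr0 0); exact: cvgD.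
by move=> t; rewrite fE gE; field.
Qed.

Lemma jet2M {f g a b c} {a' b' c' : R} : jet2 f a b c -> jet2 g a' b' c' ->
  jet2 (fun t => f t * g t) (a * a') (a * b' + b * a')
    (a * c' + 2 * b * b' + c * a').
Proof.
move=> [r r0 fE] [s s0 gE].
pose q t := a * s t + a' * r t
  + (b * (c' / 2 + s t) + b' * (c / 2 + r t)) * t
  + (c / 2 + r t) * (c' / 2 + s t) * t ^+ 2.
exists q; last by move=> t; rewrite fE gE /q; field.
have t0 : t @[t --> (0 : R)] --> (0 : R) by exact: cvg_id.
have c0 (x : R) : x @[_ --> (0 : R)] --> x by exact: cvg_cst.
have t20 : x ^+ 2 @[x --> (0 : R)] --> (0 * 0 : R).
  by under eq_fun do rewrite expr2; exact: (cvgM t0 t0).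
have p0 : (c / 2 + r x) @[x --> 0] --> c / 2 + 0 by exact: (cvgD (c0 _) r0).
have q0 : (c' / 2 + s x) @[x --> 0] --> c' / 2 + 0 by exact: (cvgD (c0 _) s0).
have : q x @[x --> 0] --> a * 0 + a' * 0
    + (b * (c' / 2 + 0) + b' * (c / 2 + 0)) * 0
    + (c / 2 + 0) * (c' / 2 + 0) * (0 * 0).
  exact: (cvgD (cvgD (cvgD (cvgM (c0 a) s0) (cvgM (c0 a') r0))
    (cvgM (cvgD (cvgM (c0 b) q0) (cvgM (c0 b') p0)) t0)) (cvgM (cvgM p0 q0) t20)).
by rewrite !mulr0 !addr0.
Qed.

Lemma jet2Z {f a b c} k : jet2 f a b c ->
  jet2 (fun t => k * f t) (k * a) (k * b) (k * c).
Proof. by move=> /(jet2M (jet2_cst k))/jet2_eq; apply; ring. Qed.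

Lemma jet2B {f g a b c} {a' b' c' : R} : jet2 f a b c -> jet2 g a' b' c' ->
  jet2 (fun t => f t - g t) (a - a') (b - b') (c - c').
Proof.
move=> fj gj; have H := jet2D fj (jet2Z (-1) gj).
apply: (jet2_ext (f := fun t => f t + -1 * g t)) => [t|]; first by rewrite mulN1r.
by apply: (jet2_eq H); ring.
Qed.

Lemma jet2_scale {f a b c} k : jet2 f a b c ->
  jet2 (fun t => f (k * t)) a (k * b) (k ^+ 2 * c).
Proof.
move=> [r r0 fE]; exists (fun t => k ^+ 2 * r (k * t)).
  rewrite -[X in _ --> X](mulr0 (k ^+ 2)); apply: cvgM; first exact: cvg_cst.
  have kt : k * t @[t --> (0 : R)] --> (0 : R).
    by rewrite -[X in _ --> X](mulr0 k); apply: cvgM; [exact: cvg_cst|exact: cvg_id].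
  exact: (cvg_comp _ _ kt r0).
by move=> t; rewrite fE; field.
Qed.

Lemma jet2X {f a b c} (n : nat) : jet2 f a b c ->
  jet2 (fun t => f t ^+ n.+2) (a ^+ n.+2) (n.+2%:R * a ^+ n.+1 * b)
    (n.+2%:R * a ^+ n.+1 * c + n.+2%:R * n.+1%:R * a ^+ n * b ^+ 2).
Proof.
move=> fj; elim: n => [|n IH].
  apply: (jet2_ext (f := fun t => f t * f t)) => [t|]; first by rewrite expr2.
  by apply: (jet2_eq (jet2M fj fj)); ring.
apply: (jet2_ext (f := fun t => f t * f t ^+ n.+2)) => [t|]; first by rewrite exprS.
apply: (jet2_eq (jet2M fj IH)); first by rewrite exprS.
  by rewrite !exprS; ring.
rewrite !exprS.
by ring.
Qed.

Lemma jet2_eps f a b c : f 0 = a ->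
  (forall e, 0 < e -> exists2 d, 0 < d &
    forall t, `|t| < d -> `|f t - (a + b * t + c / 2 * t ^+ 2)| <= e * t ^+ 2) ->
  jet2 f a b c.
Proof.
move=> f0 H; pose r t := (f t - (a + b * t + c / 2 * t ^+ 2)) / t ^+ 2.
exists r => [|t].
  apply/cvgrPdist_le => e e0; have [d d0 Hd] := H e e0.
  near=> t; rewrite sub0r normrN /r.
  have [->|t0] := eqVneq t 0; first by rewrite expr0n /= invr0 mulr0 normr0 ltW.
  have t2 : 0 < t ^+ 2 by rewrite exprn_even_gt0.
  rewrite normrM normfV (ger0_norm (ltW t2)) ler_pdivrMr//; apply: Hd.
  by near: t; exists d => // t; rewrite /= sub0r normrN.
rewrite /r; have [->|t0] := eqVneq t 0.
  by rewrite f0 mulr0 expr0n /= mulr0 !addr0.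
by field.
Unshelve. all: by end_near. Qed.

Lemma jet2_val {f a b c} : jet2 f a b c -> f 0 = a.
Proof. by move=> [r _ ->]; rewrite mulr0 expr0n /= mulr0 !addr0. Qed.

Lemma jet2_min {f a b c} : jet2 f a b c ->
  (\forall t \near (0 : R), f 0 <= f t) -> b = 0 /\ 0 <= c.
Proof.
move=> fj; rewrite (jet2_val fj); have [r r0 fE] := fj => fmin.
have rb e : 0 < e -> \forall t \near (0 : R), `|r t| < e.
  move=> e0; have /cvgrPdist_lt/(_ _ e0) := r0.
  by apply: filterS => t; rewrite sub0r normrN.
have b0 : b = 0.
  apply/eqP/negP => /negP bn0.
  pose C := `|c / 2| + 1.
  have C0 : 0 < C by rewrite /C ltr_pwDr.
  have nb : 0 < `|b| by rewrite normr_gt0.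
  have [d /= d0 Hd] : \forall t \near (0 : R), a <= f t /\ `|r t| < 1.
    by near=> t; split; near: t; [exact: fmin | exact: rb].
  (* If b is nonzero, a move of length s against its sign lowers [f]: the linear gain |b| s beats
     the quadratic term, at most C s^2, once s C <= |b| / 2. *)
  pose s := Num.min (d / 2) (`|b| / (2 * C)).
  have s0 : 0 < s.
    rewrite lt_min; apply/andP; split; first by apply: divr_gt0.
    by apply: divr_gt0 => //; apply: mulr_gt0.
  pose t := - Num.sg b * s.
  have nt : `|t| = s by rewrite normrM normrN normr_sg bn0 mul1r gtr0_norm.
  have [] : a <= f t /\ `|r t| < 1.
    apply: Hd; rewrite /= sub0r normrN nt.
    have : s <= d / 2 by rewrite ge_min lexx.
    lra.
  rewrite fE -addrA lerDl => h1 h2.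
  have bt : b * t = - (`|b| * s) by rewrite /t normrEsg; ring.
  have t2 : t ^+ 2 = s ^+ 2 by rewrite -real_normK ?nt// num_real.
  rewrite bt t2 in h1.
  have h3 : c / 2 + r t <= C.
    by rewrite /C lerD ?ler_norm//; apply: le_trans (ler_norm _) (ltW h2).
  have h4 : s * C <= `|b| / 2.
    rewrite -ler_pdivlMr//; apply: (@le_trans _ _ (`|b| / (2 * C))).
      by rewrite ge_min lexx orbT.
    by rewrite invfM mulrA.
  have h5 : (c / 2 + r t) * s ^+ 2 <= C * s ^+ 2 by rewrite ler_wpM2r// sqr_ge0.
  have h6 : C * s ^+ 2 <= `|b| / 2 * s
    by rewrite (_ : C * _ = s * C * s); [rewrite ler_wpM2r ?(ltW s0)|ring].
  have h7 : 0 < `|b| * s by apply: mulr_gt0.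
  lra.
split=> //; rewrite leNgt; apply/negP => c0.
have [d /= d0 Hd] : \forall t \near (0 : R), a <= f t /\ `|r t| < - c / 4.
  near=> t; split; near: t; first exact: fmin.
  by apply: rb; lra.
have [] : a <= f (d / 2) /\ `|r (d / 2)| < - c / 4.
  by apply: Hd; rewrite /= sub0r normrN gtr0_norm; lra.
rewrite fE b0 mul0r addr0 lerDl => h1 /(le_lt_trans (ler_norm _)) h2.
have d2 : 0 < (d / 2) ^+ 2 by rewrite exprn_gt0// divr_gt0.
move: h1; rewrite pmulr_lge0//; lra.
Unshelve. all: by end_near. Qed.

End Jet2.

(** * Second-order expansions obtained from derivatives *)

Section Taylor.
Context {R : realType}.

Lemma mvt0 (f f1 : R -> R) (d t : R) : (forall s : R, `|s| < d -> is_derive s 1 f (f1 s)) ->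
  `|t| < d -> exists2 s, `|s| <= `|t| & f t - f 0 = f1 s * t.
Proof.
move=> fd td.
have cf (s : R) : `|s| < d -> {for s, continuous f}.
  move=> sd; apply: differentiable_continuous; apply/derivable1_diffP.
  by have [] := fd s sd.
have [t0|t0|<-] := ltgtP 0 t; last first.
- by exists 0 => //; rewrite subrr mulr0.
- have sub (s : R) : s \in `[t, 0] -> `|s| <= `|t|.
    by rewrite in_itv/= => /andP[? ?]; rewrite !ler0_norm// ?lerN2// ltW.
  have [||s sI E] := @MVT _ f f1 _ _ t0.
  + by move=> s sI; apply: fd; apply: le_lt_trans td; apply/sub/subset_itv_oo_cc.
  + apply: continuous_in_subspaceT => s; rewrite inE => sI.
    by apply: cf; apply: le_lt_trans td; apply: sub.
  exists s; first by apply/sub/subset_itv_oo_cc.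
  by rewrite -[LHS]opprB E; ring.
- have sub (s : R) : s \in `[0, t] -> `|s| <= `|t|.
    by rewrite in_itv/= => /andP[? ?]; rewrite !ger0_norm// ltW.
  have [||s sI E] := @MVT _ f f1 _ _ t0.
  + by move=> s sI; apply: fd; apply: le_lt_trans td; apply/sub/subset_itv_oo_cc.
  + apply: continuous_in_subspaceT => s; rewrite inE => sI.
    by apply: cf; apply: le_lt_trans td; apply: sub.
  exists s; first by apply/sub/subset_itv_oo_cc.
  by rewrite E subr0.
Qed.

(** The reference value [H] is kept free because [jet2_cross] compares expansions based at nearby
    points with second derivatives taken at one single point. Two applications of the mean value
    theorem give the constant e rather than e / 2. *)
Lemma taylor2_bound (f f1 f2 : R -> R) (H e d t : R) :
  (forall s : R, `|s| < d -> is_derive s 1 f (f1 s)) ->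
  (forall s : R, `|s| < d -> is_derive s 1 f1 (f2 s)) ->
  (forall s : R, `|s| < d -> `|f2 s - H| <= e) ->
  `|t| < d -> `|f t - (f 0 + f1 0 * t + H / 2 * t ^+ 2)| <= e * t ^+ 2.
Proof.
move=> fd f1d f2H td.
pose q s := f s - (f 0 + f1 0 * s + H / 2 * s ^+ 2).
pose q1 s := f1 s - (f1 0 + H * s).
have qd (s : R) : `|s| < d -> is_derive s 1 q (q1 s).
  move=> sd; have := fd s sd => ?.
  by apply: is_derive_eq; rewrite /q1 /GRing.scale /=; field.
have q1d (s : R) : `|s| < d -> is_derive s 1 q1 (f2 s - H).
  move=> sd; have := f1d s sd => ?.
  by apply: is_derive_eq; rewrite /GRing.scale /=; ring.
have [s st] := mvt0 qd td.
rewrite (_ : q 0 = 0) ?subr0; last first.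
  by rewrite /q mulr0 expr0n /= mulr0 !addr0 subrr.
rewrite -/(q t) => ->.
have [r rs] := mvt0 q1d (le_lt_trans st td).
rewrite (_ : q1 0 = 0) ?subr0; last by rewrite /q1 mulr0 addr0 subrr.
move=> ->.
rewrite !normrM -[t ^+ 2]real_normK ?num_real// expr2 mulrA ler_wpM2r//.
by apply: ler_pM => //; apply: f2H; apply: le_lt_trans td; apply: le_trans st.
Qed.

Lemma jet2_derive (f f1 f2 : R -> R) (d : R) : 0 < d ->
  (forall s : R, `|s| < d -> is_derive s 1 f (f1 s)) ->
  (forall s : R, `|s| < d -> is_derive s 1 f1 (f2 s)) ->
  {for 0, continuous f2} -> jet2 f (f 0) (f1 0) (f2 0).
Proof.
move=> d0 fd f1d f2c; apply: jet2_eps => // e e0.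
have /cvgrPdist_le/(_ _ e0)[r /= r0 Hr] := f2c.
exists (Num.min d r); first by rewrite lt_min d0.
move=> t tdr; apply: (@taylor2_bound f f1 f2 (f2 0) e (Num.min d r)) => // s.
- by rewrite lt_min => /andP[sd _]; exact: fd.
- by rewrite lt_min => /andP[sd _]; exact: f1d.
- by rewrite lt_min distrC => /andP[_ sr]; apply: Hr; rewrite /= sub0r normrN.
Qed.

Lemma jet2_powR (p y : R) : 0 < y ->
  jet2 (fun t => (y + t) `^ p) (y `^ p) (p * y `^ (p - 1))
    (p * ((p - 1) * y `^ (p - 1 - 1))).
Proof.
move=> y0.
have pos s : `|s| < y -> 0 < y + s by rewrite ltr_norml => /andP[]; lra.
have dp (q s : R) : `|s| < y -> is_derive s 1 (fun t => (y + t) `^ q) (q * (y + s) `^ (q - 1)).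
  move=> sy; have Dq := is_derive1_powR q (pos s sy).
  have Dy : is_derive s 1 (fun t => y + t) 1 by apply: is_derive_eq; rewrite add0r mulr1.
  have := @is_derive1_comp _ (fun x : R => x `^ q) (fun t => y + t) s _ _ Dq Dy.
  rewrite mulr1; exact.
have := @jet2_derive (fun t => (y + t) `^ p) (fun t => p * (y + t) `^ (p - 1))
  (fun t => p * ((p - 1) * (y + t) `^ (p - 1 - 1))) y y0.
rewrite addr0; apply; first by move=> s sy; apply: is_deriveZ; apply: dp.
apply: continuousM; first exact: cvg_cst.
apply: continuousM; first exact: cvg_cst.
have /derivable1_diffP/differentiable_continuous// :
    derivable (fun t => (y + t) `^ (p - 1 - 1)) 0 1.
by have [] := dp (p - 1 - 1) 0; rewrite ?normr0.
Qed.

End Taylor.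

(** * The operator and the minimum principle *)

(** [tilt] is the vector b with (1 - [hweight]) b = a. Both the vertical direction and the tilted
    ones e_i + b_i e_y contribute to D_yy; [weight_sum] normalizes the total to 1. *)
Record coefs (R : realType) (N : nat) := Coefs {
  drift : R;
  hweight : R;
  vweight : R;
  tilt : 'I_N -> R;
  drift_gt : 0 < drift + 1;
  hweight_gt0 : 0 < hweight;
  hweight_lt1 : hweight < 1;
  vweight_gt0 : 0 < vweight;
  weight_sum : vweight + (1 - hweight) * (\sum_(i < N) tilt i ^+ 2) = 1 }.

Section Operator.
Context {R : realType} {N : nat} (L : coefs R N).
Local Notation pt := ('rV[R]_N * R)%type.
Local Notation idx := (option ('I_N * bool)).
Local Notation c := (drift L).
Implicit Types (u w : pt -> R) (z : pt) (k : idx) (g H : idx -> R).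

Definition slope k : R :=
  match k with None => 1 | Some (i, s) => if s then tilt L i else 0 end.

Definition dir k : pt :=
  (if k is Some (i, _) then delta_mx ord0 i else 0, slope k).

Definition weight k : R :=
  match k with None => vweight L
             | Some (_, s) => if s then 1 - hweight L else hweight L end.

Definition step z (d : pt) (t : R) : pt := (z.1 + t *: d.1, z.2 + t * d.2).

Definition jets w z g H : Prop :=
  forall k, jet2 (fun t => w (step z (dir k) t)) (w z) (g k) (H k).

Definition Lop (y : R) g H : R := \sum_k weight k * H k + c / y * g None.

(** Write p for this exponent. Then L(y^p) = p (p - 1 + c) y^(p - 2), which vanishes for c <= 0,
    where p = 1 - c, and is nonnegative for c > 0, where p = 1. Since p < 2, y^p dominates y^2 near
    0. *)
Definition edge_exp : R := 1 - Num.min c 0.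

(** The last clause is the Neumann condition integrated in y, so that no derivative at the edge is
    involved. Continuity on the whole space lets extrema be taken over plain compact sets; no
    equation is imposed at negative heights. *)
Definition sol u : Prop := [/\ continuous u,
  forall z, 0 < z.2 -> exists g H, jets u z g H /\ Lop z.2 g H = 0 &
  forall (x : 'rV[R]_N) (e : R), 0 < e -> exists2 d, 0 < d & forall y, 0 < y < d ->
    `|u (x, y) - u (x, 0)| <= e * y `^ edge_exp].

Lemma edge_exp_ge1 : 1 <= edge_exp.
Proof. by rewrite /edge_exp lerDl oppr_ge0 ge_min lexx orbT. Qed.

Lemma edge_exp_lt2 : edge_exp < 2.
Proof.
rewrite /edge_exp; have := drift_gt L; rewrite /Num.min; case: ifP => _; lra.
Qed.

Lemma edge_exp_sub : 0 <= edge_exp - 1 + c.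
Proof. by rewrite /edge_exp minEle; case: ifPn; rewrite -?ltNge; lra. Qed.

Lemma weight_ge0 k : 0 <= weight k.
Proof.
have := hweight_lt1 L; have := hweight_gt0 L; have := vweight_gt0 L.
by case: k => [[i []]|] /=; lra.
Qed.

Lemma sum_weight (f : idx -> R) : \sum_k weight k * f k =
  vweight L * f None + \sum_(i < N)
    (hweight L * f (Some (i, false)) + (1 - hweight L) * f (Some (i, true))).
Proof.
rewrite (bigD1 None)//=; congr (_ + _).
rewrite (reindex_omap Some id) => [|[k|]//]/=.
transitivity (\sum_(i < N) \sum_(s : bool) weight (Some (i, s)) * f (Some (i, s))).
  rewrite pair_bigA/=; apply: eq_big => [k|[i s]//]; first by rewrite eqxx.
by apply: eq_bigr => i _; rewrite big_bool/= addrC.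
Qed.

Lemma sqr_sum_step (x : 'rV[R]_N) (i : 'I_N) (t : R) :
  \sum_(j < N) (x + t *: delta_mx ord0 i) ord0 j ^+ 2 =
  \sum_(j < N) x ord0 j ^+ 2 + 2 * x ord0 i * t + t ^+ 2.
Proof.
rewrite (bigD1 i)//= [in RHS](bigD1 i)//= !mxE !eqxx mulr1.
rewrite (eq_bigr (fun j => x ord0 j ^+ 2)) => [|j ji]; first by ring.
by rewrite !mxE eqxx (negPf ji) /= mulr0 addr0.
Qed.

Definition quad (lam : R) (h : R -> R) z : R :=
  lam * (\sum_(i < N) z.1 ord0 i ^+ 2) + h z.2.

Definition gquad (lam h1 : R) z k : R :=
  (if k is Some (i, _) then 2 * lam * z.1 ord0 i else 0) + slope k * h1.

Definition Hquad (lam h2 : R) k : R :=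
  (if k is Some _ then 2 * lam else 0) + slope k ^+ 2 * h2.

Lemma jets_quad (lam : R) (h : R -> R) (h1 h2 : R) z :
  jet2 (fun t => h (z.2 + t)) (h z.2) h1 h2 ->
  jets (quad lam h) z (gquad lam h1 z) (Hquad lam h2).
Proof.
move=> hj [[i s]|]; rewrite /gquad /Hquad /quad /step /=.
  pose q (t : R) := \sum_(j < N) z.1 ord0 j ^+ 2 + 2 * z.1 ord0 i * t + t ^+ 2.
  have qj : jet2 q (\sum_(j < N) z.1 ord0 j ^+ 2) (2 * z.1 ord0 i) 2.
    exists (fun=> 0); first exact: cvg_cst.
    by move=> t; rewrite /q divff ?pnatr_eq0// addr0 mul1r.
  move: (if s then _ else _) => r.
  apply: (jet2_ext (f := fun t => lam * q t + h (z.2 + r * t))) => [t|].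
    by rewrite sqr_sum_step (mulrC t).
  apply: (jet2_eq (jet2D (jet2Z lam qj) (jet2_scale r hj))) => //; ring.
apply: (jet2_ext (f := fun t => lam * (\sum_(j < N) z.1 ord0 j ^+ 2) + h (z.2 + t))) => [t|].
  by rewrite scaler0 addr0 mulr1.
by apply: (jet2_eq (jet2D (jet2_cst _) hj)) => //; ring.
Qed.

(** In [quad] the variables x and y are separated, so tilted directions create no cross terms, and
    [weight_sum] restores the coefficient 1 of D_yy. *)
Lemma Lop_quad (lam h1 h2 y : R) z :
  Lop y (gquad lam h1 z) (Hquad lam h2) = 2 * lam * N%:R + h2 + c / y * h1.
Proof.
rewrite /Lop sum_weight /Hquad /gquad /=; congr (_ + _); last by rewrite add0r mul1r.
transitivity (2 * lam * N%:R
    + (vweight L + (1 - hweight L) * (\sum_(i < N) tilt L i ^+ 2)) * h2).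
  rewrite (eq_bigr (fun i => 2 * lam + (1 - hweight L) * h2 * tilt L i ^+ 2)); last first.
    by move=> i _; ring.
  rewrite big_split/= sumr_const card_ord -mulr_sumr -(mulr_natr _ N).
  ring.
by rewrite weight_sum mul1r.
Qed.

Lemma jetsZ m w z g H : jets w z g H ->
  jets (fun z => m * w z) z (fun k => m * g k) (fun k => m * H k).
Proof. by move=> wj k; apply: jet2Z. Qed.

Lemma LopZ m y g H : Lop y (fun k => m * g k) (fun k => m * H k) = m * Lop y g H.
Proof.
rewrite /Lop mulrDr mulr_sumr; congr (_ + _); last by ring.
by apply: eq_bigr => k _; ring.
Qed.

Lemma jetsX (n : nat) w z g H : jets w z g H ->
  jets (fun z => w z ^+ n.+2) z (fun k => n.+2%:R * w z ^+ n.+1 * g k)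
    (fun k => n.+2%:R * w z ^+ n.+1 * H k
              + n.+2%:R * n.+1%:R * w z ^+ n * g k ^+ 2).
Proof. by move=> wj k; apply: jet2X. Qed.

(** The squared gradient enters with the factor n + 1. A large power of a positive function with
    nonvanishing gradient is therefore a subsolution, whatever the sign of the operator on the
    function itself. *)
Lemma LopX (n : nat) (a y : R) g H :
  Lop y (fun k => n.+2%:R * a ^+ n.+1 * g k)
    (fun k => n.+2%:R * a ^+ n.+1 * H k
              + n.+2%:R * n.+1%:R * a ^+ n * g k ^+ 2) =
  n.+2%:R * a ^+ n * (a * Lop y g H + n.+1%:R * \sum_k weight k * g k ^+ 2).
Proof.
rewrite /Lop (eq_bigr (fun k => n.+2%:R * a ^+ n.+1 * (weight k * H k)
  + n.+2%:R * a ^+ n * n.+1%:R * (weight k * g k ^+ 2))); last first.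
  by move=> k _; ring.
by rewrite big_split/= -!mulr_sumr exprS; ring.
Qed.

Lemma step_cvg z d : step z d t @[t --> (0 : R)] --> z.
Proof.
have c1 : z.1 + t *: d.1 @[t --> (0 : R)] --> z.1.
  rewrite -[X in _ --> X]addr0; apply: cvgD; first exact: cvg_cst.
  rewrite -[X in _ --> X](scale0r d.1).
  by apply: cvgZr_tmp; exact: cvg_id.
have c2 : z.2 + t * d.2 @[t --> (0 : R)] --> z.2.
  rewrite -[X in _ --> X]addr0; apply: cvgD; first exact: cvg_cst.
  by rewrite -[X in _ --> X](mul0r d.2); apply: cvgM; [exact: cvg_id|exact: cvg_cst].
rewrite [X in _ --> X]surjective_pairing; exact: (cvg_pair c1 c2).
Qed.

Lemma continuous_norm_powR (p : R) : 1 <= p -> continuous (fun t : R => `|t| `^ p).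
Proof.
move=> p1 t; have p0 : p != 0 by rewrite gt_eqF ?(lt_le_trans ltr01).
have [->|t0] := eqVneq t 0.
  rewrite /continuous_at /= normr0 powR0//.
  apply/cvgrPdist_lt => e e0; exists (Num.min 1 e) => /=; first by rewrite lt_min ltr01.
  move=> s /=; rewrite !sub0r !normrN lt_min => /andP[s1 se].
  rewrite ger0_norm ?powR_ge0//; have [->|s0] := eqVneq s 0.
    by rewrite normr0 powR0.
  by apply: le_lt_trans se; apply: ge1r_powR => //; rewrite normr_gt0 s0 ltW.
have nt : 0 < `|t| by rewrite normr_gt0.
have gc : {for `|t|, continuous (fun s : R => s `^ p)}.
  apply/differentiable_continuous/derivable1_diffP.
  by have [] := is_derive1_powR p nt.
exact: (cvg_comp _ _ (@norm_continuous _ _ t) gc).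
Qed.

Lemma jets_edge z : 0 < z.2 ->
  exists g H, [/\ forall k, jet2 (fun t => (step z (dir k) t).2 `^ edge_exp)
    (z.2 `^ edge_exp) (g k) (H k) & 0 <= Lop z.2 g H].
Proof.
move=> z0; have hj := jet2_powR edge_exp z0.
have := @jets_quad 0 (fun t => t `^ edge_exp) _ _ z hj; set h1 := edge_exp * _; set h2 := edge_exp * _ => qj.
exists (gquad 0 h1 z), (Hquad 0 h2); split => [k|].
  have := qj k; rewrite /quad mul0r add0r; apply: jet2_ext => t.
  by rewrite mul0r add0r.
rewrite Lop_quad mulr0 mul0r add0r /h1 /h2.
have -> : z.2 `^ (edge_exp - 1) = z.2 `^ (edge_exp - 1 - 1) * z.2.
  by rewrite -[X in _ = _ * X](powRr1 (ltW z0)) -powRD ?subrK// (gt_eqF z0) implybT.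
have -> : edge_exp * ((edge_exp - 1) * z.2 `^ (edge_exp - 1 - 1))
    + c / z.2 * (edge_exp * (z.2 `^ (edge_exp - 1 - 1) * z.2))
  = edge_exp * (edge_exp - 1 + c) * z.2 `^ (edge_exp - 1 - 1).
  by field; rewrite gt_eqF.
by rewrite !mulr_ge0 ?powR_ge0 ?edge_exp_sub// (le_trans ler01 edge_exp_ge1).
Qed.

(* The multiple of y^edge_exp keeps the minimum of [u - w] off y = 0, where the
   equation says nothing about the second-order expansion of [u]. *)
Theorem minimum_principle u w (K0 E : set pt) :
  sol u -> continuous w -> compact K0 -> (forall z, K0 z -> 0 <= z.2) ->
  open E -> (forall z, E z -> 0 <= z.2 -> K0 z) ->
  (forall z, K0 z -> ~ E z -> w z <= u z) ->
  (forall z, E z -> 0 < z.2 -> exists g H, jets w z g H /\ 0 < Lop z.2 g H) ->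
  (forall x, E (x, 0) -> exists h : R, jet2 (fun t => w (x, t)) (w (x, 0)) 0 h) ->
  forall z, K0 z -> w z <= u z.
Proof.
move=> [uc uL uN] wc K0c K0y Eo EK0 wE wL wN z0 K0z0.
rewrite leNgt; apply/negP => uw.
have p1 := edge_exp_ge1; have p2 := edge_exp_lt2; set p := edge_exp in p1 p2.
have p0 : p != 0 by rewrite gt_eqF// (lt_le_trans ltr01).
(* The absolute value gives a function continuous on the whole space, across y = 0. *)
pose psi (z : pt) := `|z.2| `^ p.
have psic : continuous psi.
  move=> z; have s2 : t.2 @[t --> z] --> z.2 by exact: cvg_snd.
  exact: (cvg_comp _ _ s2 (@continuous_norm_powR p p1 z.2)).
have psi0 z : 0 <= psi z by exact: powR_ge0.
have K0n : K0 !=set0 by exists z0.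
have [zB _ HB] : exists2 zB, zB \in K0 & forall z, z \in K0 -> psi z <= psi zB.
  by apply: compact_EVT_max => //; exact: continuous_subspaceT.
(* Small enough that del B stays below the gap w z0 - u z0: outside [E], where w <= u, [f] is at
   least -del B, which exceeds f z0. The minimum of [f] is thus attained in [E]. *)
pose B := psi zB; pose del := (w z0 - u z0) / (2 * (B + 1)).
have B0 : 0 <= B := psi0 zB.
have del0 : 0 < del by apply: divr_gt0; lra.
have delB : del * B < w z0 - u z0.
  rewrite /del mulrAC ltr_pdivrMr; last by lra.
  by rewrite ltr_pM2l ?subr_gt0//; lra.
pose f z := u z - w z - del * psi z.
have [zm zmK fm] : exists2 z, z \in K0 & forall t, t \in K0 -> f z <= f t.
  apply: compact_EVT_min => //; apply: continuous_subspaceT => z.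
  apply: cvgB; first by apply: cvgB; [exact: uc|exact: wc].
  by apply: cvgM; [exact: cvg_cst|exact: psic].
rewrite inE in zmK.
have fmle z : K0 z -> f zm <= f z by move=> ?; apply: fm; rewrite inE.
have Ezm : E zm.
  apply: contrapT => /(wE _ zmK) wu; have := fmle _ K0z0; rewrite /f.
  have := HB zm; rewrite inE => /(_ zmK) h1.
  have := ler_wpM2l (ltW del0) h1; rewrite -/B => h2.
  by have := mulr_ge0 (ltW del0) (psi0 z0); lra.
(* At a minimum on the edge, moving up by a small t would change [f] by at most (del / 2) t^p + C
   t^2 - del t^p, which is negative because p < 2. At a minimum above the edge, expansions are
   compared. *)
have := K0y _ zmK; rewrite le_eqVlt => /orP[/eqP y0|y0].
  case: zm zmK fm fmle Ezm y0 => x y /= zmK fm fmle Ezm y0.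
  move: y0 zmK fm fmle Ezm => <- zmK fm fmle Ezm.
  have [h [r r0 wr]] := wN x Ezm.
  have nE : \forall t \near (0 : R), E (x, t).
    have En : \forall t \near (0 : R), E (step (x, 0) (0, 1) t).
      exact: (@step_cvg (x, 0) (0, 1) _ (open_nbhs_nbhs (conj Eo Ezm))).
    apply: filterS En => t; rewrite /= /step/= scaler0 addr0 add0r mulr1; exact.
  have nr : \forall t \near (0 : R), `|r t| < 1.
    have /cvgrPdist_lt/(_ _ ltr01) := r0.
    by apply: filterS => t; rewrite sub0r normrN.
  pose C := `|h / 2| + 1.
  have C0 : 0 < C by rewrite /C ltr_pwDr.
  have [d d0 ud] := uN x (del / 2) (divr_gt0 del0 (ltr0n _ 2)).
  have : \forall t \near (0 : R)^'+, t `^ (2 - p) < del / 2 / C.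
    have p20 : 0 < 2 - p by lra.
    have q0 : 0 < del / 2 / C by do 2?[apply: divr_gt0 => //].
    have /cvgrPdist_lt/(_ _ q0)[s /= s0 Hs] := @powR_cvg0 R (2 - p) p20.
    exists s => //= t ts t0; have := Hs t ts t0.
    by rewrite sub0r normrN ger0_norm ?powR_ge0.
  case=> e /= e0 He; case: nE => e1 /= e10 He1; case: nr => e2 /= e20 He2.
  pose t := Num.min (Num.min (e / 2) (e1 / 2)) (Num.min (e2 / 2) (d / 2)).
  have t0 : 0 < t by rewrite !lt_min !divr_gt0//.
  have := lexx t; rewrite {2}/t !le_min => /andP[/andP[te te1] /andP[te2 td]].
  have tn : `|0 - t| = t by rewrite sub0r normrN gtr0_norm.
  have h1 := He t; rewrite /= tn in h1; have {}h1 := h1 ltac:(lra) t0.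
  have h2 := He1 t; rewrite /= tn in h2; have {}h2 := h2 ltac:(lra).
  have h3 := He2 t; rewrite /= tn in h3; have {}h3 := h3 ltac:(lra).
  have h4 := ud t; rewrite t0 in h4; have {}h4 := h4 ltac:(lra).
  have h5 := fmle _ (EK0 _ h2 (ltW t0)).
  rewrite /f /psi /= normr0 powR0// (gtr0_norm t0) (wr t) mul0r addr0 mulr0 subr0 in h5.
  have h6 : `|h / 2 + r t| <= C.
    by rewrite (le_trans (ler_normD _ _))// lerD// ltW.
  have h7 : t `^ p * t `^ (2 - p) = t ^+ 2.
    rewrite -powRD; last by rewrite (gt_eqF t0) implybT.
    by rewrite addrC subrK -powR_mulrn// ltW.
  have tp : 0 < t `^ p by rewrite powR_gt0.
  have h8 : C * t `^ (2 - p) < del / 2 by rewrite mulrC -ltr_pdivlMr.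
  have h9 : C * t ^+ 2 < del / 2 * t `^ p.
    by rewrite -h7 mulrCA mulrC ltr_pM2r.
  have h10 : - ((h / 2 + r t) * t ^+ 2) <= C * t ^+ 2.
    rewrite -mulNr ler_wpM2r ?sqr_ge0//; apply: le_trans h6.
    by rewrite -normrN ler_norm.
  have h11 := ler_norm (u (x, t) - u (x, 0)).
  lra.
have [gu [Hu [uj Lu]]] := uL zm y0; have [gw [Hw [wj Lw]]] := wL zm Ezm y0.
have [gp [Hp [pj Lp]]] := jets_edge y0.
(* At the minimum the slopes agree and the second derivatives are ordered in each direction. With
   nonnegative weights this gives 0 = L u >= L w + del L psi > 0. *)
have cmp k : gu k = gw k + del * gp k /\ Hw k + del * Hp k <= Hu k.
  have fj := jet2B (jet2B (uj k) (wj k)) (jet2Z del (pj k)).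
  have [|h1 h2] := jet2_min fj; last by split; lra.
  have sc := @step_cvg zm (dir k).
  have n1 : \forall t \near (0 : R), E (step zm (dir k) t).
    exact: (sc _ (open_nbhs_nbhs (conj Eo Ezm))).
  have s1 : t.2 @[t --> zm] --> zm.2 by exact: cvg_snd.
  have s2 := cvg_comp _ _ sc s1.
  have n2 : \forall t \near (0 : R), 0 < (step zm (dir k) t).2.
    exact: (s2 _ (lt_nbhsr y0)).
  apply: filterS2 n1 n2 => t /= h1 h2.
  have := fmle _ (EK0 _ h1 (ltW h2)).
  rewrite /f /psi (gtr0_norm h2) (gtr0_norm y0).
  by rewrite [step _ _ 0]/step scale0r mul0r !addr0 -surjective_pairing.
have : Lop zm.2 gw Hw + del * Lop zm.2 gp Hp <= Lop zm.2 gu Hu.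
  rewrite /Lop (proj1 (cmp None)) !mulrDr mulr_sumr.
  rewrite addrACA -big_split/=; apply: lerD; last by rewrite mulrCA.
  apply: ler_sum => k _; rewrite mulrCA -mulrDr ler_wpM2l ?weight_ge0//.
  exact: (proj2 (cmp k)).
have := mulr_ge0 (ltW del0) Lp; lra.
Qed.

End Operator.

(** * Barriers *)

Section LevelSets.
Context {R : realType} {T : topologicalType}.
Implicit Types (f : T -> R) (k : R).

Lemma closed_sublevel f k : continuous f -> closed [set z | f z <= k].
Proof. by move=> fc; apply: closed_comp (@closed_le _ k) => z _; exact: fc. Qed.

Lemma open_sublevel f k : continuous f -> open [set z | f z < k].
Proof. by move=> fc; apply: open_comp (@open_lt _ k) => z _; exact: fc. Qed.

End LevelSets.

Section RowNorm.
Context {R : realType} {N : nat}.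
Implicit Types (x : 'rV[R]_N).

Lemma normr_coord x i : `|x ord0 i| <= `|x|.
Proof.
rewrite [leRHS](mx_normrE x).
exact: (le_bigmax _ (fun ij => `|x ij.1 ij.2|) (ord0, i)).
Qed.

Lemma normr_row_le x (r : R) : 0 <= r -> (forall i, `|x ord0 i| <= r) -> `|x| <= r.
Proof.
move=> r0 xr; rewrite [leLHS](mx_normrE x); apply: bigmax_le => // -[i j] _ /=.
by rewrite (ord1 i).
Qed.

Definition sqsum x : R := \sum_(i < N) x ord0 i ^+ 2.

Lemma sqsum_ge0 x : 0 <= sqsum x.
Proof. by apply: sumr_ge0 => i _; rewrite sqr_ge0. Qed.

Lemma sqsum_ge x : `|x| ^+ 2 <= sqsum x.
Proof.
have [/eqP|x0] := eqVneq (mx_norm x) 0.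
  by rewrite -[mx_norm x]/(`|x|) => /eqP ->; rewrite expr0n sqsum_ge0.
have [[i j] /= xE] := mx_norm_neq0 x0; rewrite (ord1 i) in xE.
rewrite -[`|x|]/(mx_norm x) xE real_normK ?num_real// /sqsum (bigD1 j)//=.
by rewrite lerDl sumr_ge0// => k _; rewrite sqr_ge0.
Qed.

Lemma sqsum_le x (r : R) : `|x| <= r -> sqsum x <= N%:R * r ^+ 2.
Proof.
move=> xr; rewrite /sqsum -[N in leRHS]card_ord mulr_natl -sumr_const.
apply: ler_sum => i _; rewrite -[leLHS]real_normK ?num_real//.
rewrite lerXn2r ?nnegrE// ?(le_trans (normr_ge0 _) xr)//.
exact: le_trans (normr_coord _ _) xr.
Qed.

Lemma sqsum_continuous : continuous sqsum.
Proof.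
have sc (s : seq 'I_N) : continuous (fun x : 'rV[R]_N => \sum_(i <- s) x ord0 i ^+ 2).
  elim: s => [|i s IH] x; rewrite /continuous_at.
    by rewrite big_nil; under eq_fun do rewrite big_nil; exact: (@cst_continuous _ _ (0 : R) x).
  rewrite big_cons; under eq_fun do rewrite big_cons.
  have ci := @coord_continuous R 1 N ord0 i x.
  have c1 : (fun y : 'rV[R]_N => y ord0 i ^+ 2) @ x --> x ord0 i ^+ 2.
    exact: (cvg_comp _ _ ci (@exprn_continuous _ 2 _)).
  exact: (cvgD c1 (IH x)).
exact: sc.
Qed.

End RowNorm.

Section Barriers.
Context {R : realType} {N : nat} (L : coefs R N).
Local Notation pt := ('rV[R]_N * R)%type.
Local Notation c := (drift L).
Implicit Types (u w : pt -> R) (z : pt) (lam : R).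

Lemma fst_continuous : continuous (fun z : pt => z.1).
Proof. by move=> z; exact: cvg_fst. Qed.

Lemma snd_continuous : continuous (fun z : pt => z.2).
Proof. by move=> z; exact: cvg_snd. Qed.

Lemma norm1_continuous : continuous (fun z : pt => `|z.1|).
Proof. by move=> z; exact: (cvg_comp _ _ (@fst_continuous z) (@norm_continuous _ _ z.1)). Qed.

Lemma quad_continuous lam (h : R -> R) : continuous h -> continuous (quad (N := N) lam h).
Proof.
move=> hc z; apply: (@cvgD _ _ _ _ _ _ _ (lam * sqsum z.1) (h z.2)).
  apply: cvgM; first exact: cvg_cst.
  exact: (cvg_comp _ _ (@fst_continuous z) (@sqsum_continuous R N z.1)).
exact: (cvg_comp _ _ (@snd_continuous z) (hc z.2)).
Qed.

Lemma compact_slab (r lo hi : R) :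
  compact [set z : pt | `|z.1| <= r /\ lo <= z.2 <= hi].
Proof.
have cx : compact [set x : 'rV[R]_N | `|x| <= r].
  apply: bounded_closed_compact; last exact: closed_sublevel (@norm_continuous _ _).
  exists r; split; first exact: num_real.
  by move=> s rs x /= xr; apply: le_trans xr (ltW rs).
apply: (subclosed_compact _ (compact_setX cx (@segment_compact R lo hi))).
  have -> : [set z : pt | `|z.1| <= r /\ lo <= z.2 <= hi]
    = [set z : pt | `|z.1| <= r] `&` ([set z | - z.2 <= - lo] `&` [set z | z.2 <= hi]).
    by apply/seteqP; split=> z /=; rewrite lerN2 => -[? /andP].
  apply: closedI; last apply: closedI; apply: closed_sublevel.
  - exact: norm1_continuous.
  - by move=> z; apply: cvgN; exact: snd_continuous.
  - exact: snd_continuous.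
by move=> z [zr zy]; split=> //=; rewrite in_itv.
Qed.

Lemma sol_affine u (m k : R) : sol L u -> sol L (fun z => m * u z + k).
Proof.
move=> [uc uL uN]; split.
- move=> z; apply: cvgD; last exact: cvg_cst.
  by apply: cvgM; [exact: cvg_cst|exact: uc].
- move=> z z0; have [g [H [uj Lu]]] := uL z z0.
  exists (fun k => m * g k), (fun k => m * H k); split.
    move=> j; apply: (jet2_eq (jet2D (jet2Z m (uj j)) (jet2_cst k))) => //; ring.
  by rewrite LopZ Lu mulr0.
- move=> x e e0; have m0 : 0 < `|m| + 1 by rewrite ltr_wpDl.
  have [d d0 Hd] := uN x _ (divr_gt0 e0 m0); exists d => // y yd.
  have := Hd y yd; set D := u (x, y) - u (x, 0) => HD.
  rewrite (_ : _ - _ = m * D); last by rewrite /D; ring.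
  rewrite normrM; have := ler_wpM2l (normr_ge0 m) HD => /le_trans; apply.
  rewrite mulrA ler_wpM2r ?powR_ge0// mulrA ler_pdivrMr// mulrC.
  by rewrite ler_wpM2l ?(ltW e0)// lerDl.
Qed.

Lemma sol_dilate u (x0 : 'rV[R]_N) (rho : R) : 0 < rho -> sol L u ->
  sol L (fun z => u (x0 + rho *: z.1, rho * z.2)).
Proof.
move=> r0 [uc uL uN]; split.
- move=> z; have c1 : x0 + rho *: t.1 @[t --> z] --> x0 + rho *: z.1.
    apply: cvgD; first exact: cvg_cst.
    by apply: cvgZl_tmp; exact: fst_continuous.
  have c2 : rho * t.2 @[t --> z] --> rho * z.2.
    by apply: cvgM; [exact: cvg_cst|exact: snd_continuous].
  exact: (cvg_comp _ _ (cvg_pair c1 c2) (uc (x0 + rho *: z.1, rho * z.2))).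
- move=> z z0; have [|g [H [uj Lu]]] := uL (x0 + rho *: z.1, rho * z.2).
    by rewrite /= mulr_gt0.
  exists (fun k => rho * g k), (fun k => rho ^+ 2 * H k); split.
    move=> k; apply: jet2_ext (jet2_scale rho (uj k)) => t.
    rewrite /step/=; congr u; congr pair; last by ring.
    by rewrite scalerDr scalerA addrA.
  rewrite -[RHS](mulr0 (rho ^+ 2)) -Lu /Lop mulrDr mulr_sumr; congr (_ + _).
    by apply: eq_bigr => k _; ring.
  by rewrite /=; field; rewrite !gt_eqF.
- move=> x e e0; set p := edge_exp L.
  have rp : 0 < rho `^ p by rewrite powR_gt0.
  have [d d0 Hd] := uN (x0 + rho *: x) (e / rho `^ p) (divr_gt0 e0 rp).
  exists (d / rho); first exact: divr_gt0.
  move=> y /andP[y0 yd]; have := Hd (rho * y); rewrite /= mulr0.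
  rewrite mulr_gt0//= mulrC -ltr_pdivlMr// yd => /(_ isT) /le_trans; apply.
  by rewrite (mulrC y) powRM ?(ltW r0) ?(ltW y0)// mulrA divfK// gt_eqF.
Qed.

(** The tilted directions are discarded: the directions e_i and e_y, of weights [hweight] and
    [vweight], already control the full gradient. *)
Lemma gquad_norm_ge lam (h1 : R) z :
  4 * hweight L * lam ^+ 2 * sqsum z.1 + vweight L * h1 ^+ 2
  <= \sum_k weight L k * gquad L lam h1 z k ^+ 2.
Proof.
rewrite sum_weight addrC /gquad /= add0r mul1r lerD2l /sqsum mulr_sumr.
apply: ler_sum => i _; have k1 := hweight_lt1 L.
have : 0 <= (1 - hweight L) * (2 * lam * z.1 ord0 i + tilt L i * h1) ^+ 2.
  by apply: mulr_ge0; [lra|exact: sqr_ge0].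
rewrite mul0r addr0; lra.
Qed.

(** With Q the quadratic profile and G = K - Q, [LopX] shows that L(G^(n+2)) is a positive multiple
    of (n + 1) times the gradient energy of Q minus G L(Q). The last hypothesis is the positivity of
    this quantity, with the energy replaced by its lower bound. *)
Lemma barrier_subsol (n : nat) (m K lam : R) (h : R -> R) (h1 h2 : R) z :
  0 < m -> quad lam h z < K ->
  jet2 (fun t => h (z.2 + t)) (h z.2) h1 h2 ->
  0 < n.+1%:R * (4 * hweight L * lam ^+ 2 * sqsum z.1 + vweight L * h1 ^+ 2)
    - (K - quad lam h z) * (2 * lam * N%:R + h2 + c / z.2 * h1) ->
  exists g H, jets L (fun z => m * (K - quad lam h z) ^+ n.+2) z g H /\
    0 < Lop L z.2 g H.
Proof.
move=> m0 zK hj pos; have qj := jets_quad L lam hj.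
have Kj : jets L (fun z => K - quad lam h z) z (fun k => - 1 * gquad L lam h1 z k)
    (fun k => - 1 * Hquad L lam h2 k).
  by move=> k; apply: (jet2_eq (jet2B (jet2_cst K) (qj k))) => //; rewrite sub0r mulN1r.
have G0 : 0 < K - quad lam h z by rewrite subr_gt0.
have := jetsZ m (jetsX n Kj) => Wj; do 2 eexists; split; first exact: Wj.
rewrite LopZ LopX LopZ Lop_quad; apply: mulr_gt0 => //; apply: mulr_gt0.
  by rewrite mulr_gt0// exprn_gt0.
rewrite (eq_bigr (fun k => weight L k * gquad L lam h1 z k ^+ 2)); last first.
  by move=> k _; rewrite mulN1r sqrrN.
have := ler_wpM2l (ler0n R n.+1) (gquad_norm_ge lam h1 z); lra.
Qed.

Lemma barrier_edge (n : nat) (m K lam : R) (h : R -> R) (h2 : R) (x : 'rV[R]_N) :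
  jet2 h (h 0) 0 h2 ->
  exists H, jet2 (fun t => m * (K - quad lam h (x, t)) ^+ n.+2)
    (m * (K - quad lam h (x, 0)) ^+ n.+2) 0 H.
Proof.
move=> hj.
have qj := jet2D (jet2_cst (lam * sqsum x)) hj.
have := jet2Z m (jet2X n (jet2B (jet2_cst K) qj)) => wj.
by eexists; apply: (jet2_eq wj) => //; ring.
Qed.

Lemma barrier_continuous (n : nat) (m K lam : R) (h : R -> R) : continuous h ->
  continuous (fun z : pt => m * (K - quad lam h z) ^+ n).
Proof.
move=> hc z; apply: cvgM; first exact: cvg_cst.
have qc : K - quad lam h t @[t --> z] --> K - quad lam h z.
  by apply: cvgB; [exact: cvg_cst|exact: quad_continuous].
exact: (cvg_comp _ _ qc (@exprn_continuous _ n _)).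
Qed.

End Barriers.

(** * From a large value near y = 0 to a point at height one *)

Section Spreading.
Context {R : realType} {N : nat} (L : coefs R N).
Local Notation pt := ('rV[R]_N * R)%type.
Local Notation c := (drift L).
Implicit Types (u : pt -> R) (z : pt).

Lemma exists_nat_gt (x : R) : exists n : nat, x < n.+1%:R.
Proof.
exists (Num.bound x); apply: (le_lt_trans (ler_norm x)).
apply: (@lt_trans _ _ (Num.bound x)%:R); last by rewrite ltr_nat.
by have := archi_boundP (normr_ge0 x); rewrite /Num.bound normr_id.
Qed.

Lemma jet2_sqr_shift (y k : R) :
  jet2 (fun t => (y + t - k) ^+ 2) ((y - k) ^+ 2) (2 * (y - k)) 2.
Proof.
apply: (jet2_ext (f := fun t => (y - k + 1 * t) ^+ 2)) => [t|]; first by ring.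
have := jet2X 0 (jet2_affine (y - k) 1).
rewrite expr1 expr0 !mulr1 mulr0 add0r expr1n mulr1; exact.
Qed.

(** If u stayed below 2/3 M on the top, the supersolution 2/3 M + A (|x|^2 + C (1 - y^2)) would
    dominate u in the cylinder: A Lam^2 = 2 M takes care of the lateral side. At (0, y1) this
    function is below M, a contradiction. *)
Lemma cylinder : exists2 Lam : R, 1 <= Lam & forall u (M y1 : R),
  sol L u -> 0 < M -> 0 <= y1 <= 1 -> M <= u (0, y1) ->
  (forall z, `|z.1| <= Lam -> 0 <= z.2 <= 1 -> u z <= 2 * M) ->
  exists2 x : 'rV[R]_N, `|x| <= Lam & 2 / 3 * M <= u (x, 1).
Proof.
(* C (c + 1) = N + 1, so the operator sends |x|^2 + C (1 - y^2) to 2 N - 2 (N + 1) = -2. *)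
have c1 := drift_gt L; pose C := (N%:R + 1) / (c + 1).
have C0 : 0 < C by rewrite divr_gt0// ltr_wpDl.
have CE : C * (c + 1) = N%:R + 1 by rewrite /C divfK// gt_eqF.
(* Lam^2 > Lam > 6 C gives A C < M / 3, which keeps the barrier below M on the axis. *)
pose Lam := 6 * C + 1; have Lam1 : 1 < Lam by rewrite /Lam; lra.
exists Lam; first exact: ltW.
move=> u M y1 us M0 /andP[y10 y11] uM u2M; apply: contrapT => nex.
have top x : `|x| <= Lam -> u (x, 1) <= 2 / 3 * M.
  by move=> xL; rewrite leNgt; apply/negP => h; apply: nex; exists x => //; exact: ltW.
have Lam0 : 0 <= Lam by rewrite (le_trans ler01)// ltW.
have LL : Lam < Lam ^+ 2 by rewrite expr2 ltr_pMl// (lt_trans ltr01).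
have Lsq0 : 0 < Lam ^+ 2 by rewrite exprn_gt0// (lt_trans ltr01).
pose A := 2 * M / Lam ^+ 2; have A0 : 0 < A by rewrite divr_gt0// mulr_gt0.
have AL : A * Lam ^+ 2 = 2 * M by rewrite /A divfK// gt_eqF.
pose h (y : R) := - (2 / 3 * M) - A * (C * (1 - y ^+ 2)).
have hj y : jet2 (fun t => h (y + t)) (h y) (2 * A * C * y) (2 * A * C).
  have Hq := jet2Z (A * C) (jet2_sqr_shift y 0).
  have := jet2D (jet2_cst (- (2 / 3 * M) - A * C)) Hq => /jet2_eq H.
  apply: (jet2_ext (f := fun t => - (2 / 3 * M) - A * C + A * C * (y + t - 0) ^+ 2)).
    by move=> t; rewrite /h; ring.
  by apply: H; rewrite /h; ring.
have hc : continuous h.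
  move=> y; apply: cvgB; first exact: cvg_cst.
  apply: cvgM; first exact: cvg_cst.
  apply: cvgM; first exact: cvg_cst.
  apply: cvgB; first exact: cvg_cst.
  exact: exprn_continuous.
pose K0 := [set z : pt | `|z.1| <= Lam /\ 0 <= z.2 <= 1].
pose E := [set z : pt | `|z.1| < Lam] `&` [set z | z.2 < 1].
have us' := sol_affine (-1) 0 us.
have := @minimum_principle R N L _ (quad (- A) h) K0 E us' (quad_continuous hc).
move=> /(_ (@compact_slab R N Lam 0 1)) H.
have : quad (- A) h ((0, y1) : pt) <= -1 * u (0, y1) + 0.
  apply: H => //=.
  - by move=> z [_ /andP[]].
  - by apply: openI; apply: open_sublevel; [exact: norm1_continuous|exact: snd_continuous].
  - by move=> z [/= zL z1] z0; split; [exact: ltW|rewrite z0 ltW].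
  - move=> z [zL zy] nE; have := u2M z zL zy; have [zL'|zL'] := ltP `|z.1| Lam.
      have z1 : z.2 = 1.
        apply/eqP; rewrite eq_le; move/andP: (zy) => [_ ->] /=.
        by rewrite leNgt; apply/negP => z1; apply: nE.
      have := top _ zL; case: z z1 {zL zy nE zL'} => x y /= -> uT _.
      rewrite /quad /h /= -/(sqsum x); have := mulr_ge0 (ltW A0) (sqsum_ge0 x).
      by rewrite expr1n subrr !mulr0; lra.
    have S1 : Lam ^+ 2 <= sqsum z.1.
      by apply: le_trans (sqsum_ge z.1); rewrite lerXn2r// nnegrE.
    have := ler_wpM2l (ltW A0) S1; rewrite AL /quad /h -/(sqsum z.1) => h1 h2.
    have : 0 <= A * (C * (1 - z.2 ^+ 2)).
      rewrite mulr_ge0 ?(ltW A0)// mulr_ge0 ?(ltW C0)// subr_ge0.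
      by move/andP: zy => [z0 z1]; rewrite -[leRHS](expr1n _ 2) lerXn2r ?nnegrE.
    lra.
  - move=> z _ z0; exists (gquad L (- A) (2 * A * C * z.2) z), (Hquad L (- A) (2 * A * C)).
    split; first exact: jets_quad.
    rewrite Lop_quad (_ : _ + _ = 2 * A * (C * (c + 1) - N%:R)); last first.
      by field; rewrite gt_eqF.
    by rewrite CE mulr_gt0//; [rewrite mulr_gt0|lra].
  - move=> x _; exists (2 * A * C); have := hj 0; rewrite mulr0 => hj0.
    have := jet2D (jet2_cst (- A * sqsum x)) hj0; rewrite add0r.
    rewrite add0r; apply: jet2_ext => t; by rewrite /quad /= add0r.
  - by split; [rewrite normr0 (le_trans ler01)// ltW|rewrite y10].
rewrite /quad /h /= -/(sqsum (0 : 'rV[R]_N)).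
have -> : sqsum (0 : 'rV[R]_N) = 0.
  by rewrite /sqsum big1// => i _; rewrite mxE expr0n.
have : A * (C * (1 - y1 ^+ 2)) <= A * C.
  by rewrite ler_wpM2l ?(ltW A0)// ler_piMr ?(ltW C0)// gerBl sqr_ge0.
have : 6 * (A * C) < 2 * M.
  rewrite -AL mulrCA ltr_pM2l//; apply: lt_trans LL; rewrite /Lam; lra.
lra.
Qed.

End Spreading.

(** * From a horizontal disc to a ball below it *)

Section Growth.
Context {R : realType} {N : nat} (L : coefs R N).
Local Notation pt := ('rV[R]_N * R)%type.
Local Notation c := (drift L).
Implicit Types (u : pt -> R) (z : pt).

Lemma barrier_le (K m G : R) (n : nat) : 0 < K -> 0 <= m -> 0 <= G <= K ->
  m / K ^+ n * G ^+ n <= m.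
Proof.
move=> K0 m0 /andP[G0 GK]; rewrite mulrAC ler_pdivrMr ?exprn_gt0//.
by rewrite ler_wpM2l// lerXn2r ?nnegrE// ltW.
Qed.

Lemma barrier_ge (K m G s : R) (n : nat) : 0 < K -> 0 <= m -> 0 <= s <= G ->
  (s / K) ^+ n * m <= m / K ^+ n * G ^+ n.
Proof.
move=> K0 m0 /andP[s0 sG]; rewrite expr_div_n mulrC mulrCA [leLHS]mulrC.
rewrite ler_wpM2l ?lerXn2r ?nnegrE ?(le_trans s0 sG)//.
by rewrite divr_ge0// exprn_ge0// ltW.
Qed.

(** The barrier is a power of K - |x|^2 - (y - y1 - 1)^2, positive in a ball about (0, y1 + 1) of
    squared radius 1 + e^2. The part of this ball below height y1 is a thin lens whose flat top is
    the Euclidean disc of radius e, where u >= m. The centre is at distance at least 1 from the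
    lens, so the gradient is bounded below there; the lens lies in y >= 1/2, where c / y is
    bounded. *)
Lemma lens (e : R) : 0 < e -> e ^+ 2 <= 1 / 2 ->
  exists2 kap : R, 0 < kap & forall u (y1 m : R), sol L u ->
  (forall z, 0 <= z.2 -> 0 <= u z) -> 1 <= y1 -> 0 < m ->
  (forall x : 'rV[R]_N, `|x| <= e -> m <= u (x, y1)) ->
  forall z, `|z.1| <= e ^+ 2 / (8 * N.+1%:R) ->
    `|z.2 - (y1 - e ^+ 2 / 4)| <= e ^+ 2 / (8 * N.+1%:R) -> kap * m <= u z.
Proof.
move=> e0; set q := e ^+ 2 => q12; have q0 : 0 < q by rewrite exprn_gt0.
have v0 := vweight_gt0 L.
(* Bounds the operator on the profile: on the lens y >= 1/2 and |y - y1 - 1| <= 3/2, so the drift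
   contributes at most 6 |c|. *)
pose C2 : R := 2 * N%:R + 2 + 6 * `|c|.
have C20 : 0 < C2 by rewrite /C2 -addrA ltr_wpDl ?mulr_ge0// ltr_pwDl// mulr_ge0.
(* 2 bounds K minus the profile on the lens, and 4 [vweight] bounds the gradient energy from
   below. *)
have [n nE] := exists_nat_gt (2 * C2 / (4 * vweight L)).
rewrite ltr_pdivrMr ?mulr_gt0// in nE.
pose K := 1 + q; have K0 : 0 < K by rewrite /K; lra.
(* On the target ball K minus the profile is at least q / 10 (see [low]). *)
exists (((q / 10) / K) ^+ n.+2); first by rewrite exprn_gt0// !divr_gt0.
move=> u y1 m us u0 y11 m0 um.
pose h (y : R) := (y - (y1 + 1)) ^+ 2.
have hc : continuous h.
  move=> y; have yc : y - (y1 + 1) @[y --> y] --> y - (y1 + 1).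
    by apply: cvgB; [exact: cvg_id|exact: cvg_cst].
  exact: (cvg_comp _ _ yc (@exprn_continuous _ 2 _)).
pose w z := m / K ^+ n.+2 * (K - quad (N := N) 1 h z) ^+ n.+2.
have mK : 0 < m / K ^+ n.+2 by rewrite divr_gt0// exprn_gt0.
pose K0s := [set z : pt | quad 1 h z <= K] `&` [set z | z.2 <= y1].
pose E := [set z : pt | quad 1 h z < K] `&` [set z | z.2 < y1].
have quadE z : quad 1 h z = sqsum z.1 + (z.2 - (y1 + 1)) ^+ 2 by rewrite /quad mul1r.
have inK z : quad 1 h z <= K -> `|z.1| <= 3 / 2 /\ `|z.2 - (y1 + 1)| <= 3 / 2.
  rewrite quadE /K => zK; have := sqsum_ge0 z.1; have := sqsum_ge z.1.
  have h1 := sqr_ge0 (z.2 - (y1 + 1)); move=> h2 h3.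
  split; rewrite -[leLHS]ger0_norm// -ler_sqr ?nnegrE// ?normr_id.
    by rewrite (le_trans h2)//; lra.
  by rewrite real_normK ?num_real//; lra.
have K0sy z : K0s z -> 1 / 2 <= z.2.
  by move=> [/inK[_ +] _]; rewrite ler_norml => /andP[h1 _]; lra.
have wc : continuous w by exact: barrier_continuous.
move=> z; set rho := q / (8 * N.+1%:R) => z1 z2.
have N0 : 0 < 8 * N.+1%:R :> R by rewrite mulr_gt0.
have rho0 : 0 < rho by rewrite divr_gt0.
have rhoE : rho * (8 * N.+1%:R) = q by rewrite /rho divfK// gt_eqF.
have NS : N.+1%:R = N%:R + 1 :> R by rewrite -natr1.
have N0' : 0 <= N%:R :> R by [].
have rho8 : 8 * rho <= q.
  by rewrite -rhoE NS; have := mulr_ge0 N0' (ltW rho0); lra.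
have Nrho : N%:R * rho <= q / 8 by rewrite NS in rhoE; lra.
have low : q / 10 <= K - quad 1 h z.
  rewrite quadE; have := sqsum_le z1.
  have : N%:R * rho ^+ 2 <= q / 8 * rho by rewrite expr2 mulrA ler_wpM2r// ltW.
  pose s := y1 - z.2; rewrite (_ : z.2 - (y1 + 1) = - (s + 1)); last by rewrite /s; ring.
  move: z2; rewrite ler_norml => /andP[z2 z3].
  have s0 : 0 <= s by rewrite /s; lra.
  have s1 : s <= 3 / 8 * q by rewrite /s; lra.
  have : s ^+ 2 <= 3 / 8 * q * (3 / 8 * (1 / 2)) by rewrite expr2 ler_pM//; lra.
  have : q / 8 * rho <= q / 8 * (1 / 16) by rewrite ler_wpM2l//; lra.
  rewrite sqrrN sqrrD1 /K; lra.
have zK : K0s z.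
  split=> /=; first by lra.
  by move: z2; rewrite ler_norml => /andP[_]; lra.
apply: (@le_trans _ _ (w z)); first by apply: barrier_ge; rewrite ?low ?ltW ?divr_gt0.
move: z zK {z1 z2 low}; apply: (minimum_principle (E := E) us wc).
- apply: (subclosed_compact _ (@compact_slab R N (3 / 2) (1 / 2) y1)).
    apply: closedI; apply: closed_sublevel; [exact: quad_continuous|exact: snd_continuous].
  by move=> t tK; have [t1 t2] := tK; split; [case: (inK t t1)|rewrite (K0sy t tK)].
- by move=> t /K0sy; lra.
- by apply: openI; apply: open_sublevel; [exact: quad_continuous|exact: snd_continuous].
- by move=> t [/= h1 h2] _; split; exact: ltW.
- move=> t tK nE'; have [/= t1 t2] := tK; have t3 := K0sy t tK.
  have tu : 0 <= u t by apply: u0; lra.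
  move: t1; rewrite le_eqVlt => /orP[/eqP t1|t1].
    by rewrite /w t1 subrr expr0n mulr0.
  have ty : t.2 = y1.
    by apply/eqP; rewrite eq_le t2 leNgt; apply/negP => ty; apply: nE'.
  have tx : `|t.1| <= e.
    rewrite -[leLHS]ger0_norm// -ler_sqr ?nnegrE ?normr_id ?(ltW e0)//.
    apply: le_trans (sqsum_ge _) _; move: t1; rewrite quadE ty /K.
    rewrite (_ : y1 - (y1 + 1) = -1); last by ring.
    by rewrite sqrrN expr1n -/q; lra.
  have := um _ tx; rewrite -ty -surjective_pairing; apply: le_trans.
  apply: barrier_le; rewrite ?(ltW m0)// subr_ge0 (ltW t1) gerBl quadE.
  by rewrite addr_ge0 ?sqsum_ge0 ?sqr_ge0.
- move=> t [/= t1 t2] t0; apply: (barrier_subsol (h1 := 2 * (t.2 - (y1 + 1))) (h2 := 2)) => //.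
    exact: jet2_sqr_shift.
  have tK : K0s t by split; exact: ltW.
  have t3 := K0sy t tK; have [_ t4] := inK t (ltW t1).
  have G2 : K - quad 1 h t <= 2.
    by rewrite quadE /K; have := sqsum_ge0 t.1; have := sqr_ge0 (t.2 - (y1 + 1)); lra.
  have d2 : 1 <= (t.2 - (y1 + 1)) ^+ 2.
    by rewrite -sqrrN -[leLHS](expr1n _ 2) lerXn2r ?nnegrE; lra.
  have cB : c / t.2 * (2 * (t.2 - (y1 + 1))) <= 6 * `|c|.
    apply: (le_trans (ler_norm _)); rewrite !normrM normfV.
    rewrite -mulrA [leRHS]mulrC ler_wpM2l// (gtr0_norm t0) mulrC ler_pdivrMr//.
    rewrite ger0_norm//; lra.
  have paren : 2 * 1 * N%:R + 2 + c / t.2 * (2 * (t.2 - (y1 + 1))) <= C2.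
    by rewrite /C2; lra.
  have h1 : (K - quad 1 h t) * (2 * 1 * N%:R + 2 + c / t.2 * (2 * (t.2 - (y1 + 1))))
      <= 2 * C2.
    have Gt0 : 0 <= K - quad 1 h t by rewrite subr_ge0 ltW.
    apply: le_trans (ler_wpM2l Gt0 paren) _.
    by rewrite ler_wpM2r// ltW.
  have h2 : n.+1%:R * (4 * vweight L) <= n.+1%:R * (4 * hweight L * 1 ^+ 2 * sqsum t.1
      + vweight L * (2 * (t.2 - (y1 + 1))) ^+ 2).
    rewrite ler_wpM2l// exprMn.
    have := mulr_ge0 (ltW (hweight_gt0 L)) (sqsum_ge0 t.1).
    have := ler_wpM2l (ltW v0) d2; lra.
  lra.
- move=> x [/= /ltW xK /ltW y10]; have := K0sy (x, 0) (conj xK y10).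
  by rewrite /= leNgt divr_gt0.
Qed.

End Growth.

(** * From a box to one five times larger *)

Section BoxGrowth.
Context {R : realType} {N : nat} (L : coefs R N).
Local Notation pt := ('rV[R]_N * R)%type.
Local Notation c := (drift L).
Implicit Types (u : pt -> R) (z : pt).

(** A substitute for (y - Y)^2 that is even in y, hence has zero slope at the edge as the minimum
    principle demands. It equals (y - Y)^2 ((y + Y) / Y)^2, and on boxes of fixed size about height
    Y the extra factor is bounded uniformly in Y >= 1. *)
Definition bowl (Y y : R) : R := (y ^+ 2 - Y ^+ 2) ^+ 2 / Y ^+ 2.

Lemma bowl_continuous Y : continuous (bowl Y).
Proof.
move=> y; apply: cvgM; last exact: cvg_cst.
have yc : (y ^+ 2 - Y ^+ 2) @[y --> y] --> y ^+ 2 - Y ^+ 2.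
  by apply: cvgB; [exact: exprn_continuous|exact: cvg_cst].
exact: (cvg_comp _ _ yc (@exprn_continuous _ 2 _)).
Qed.

Lemma jet2_bowl Y y : jet2 (fun t => bowl Y (y + t)) (bowl Y y)
  (4 * y * (y ^+ 2 - Y ^+ 2) / Y ^+ 2) ((12 * y ^+ 2 - 4 * Y ^+ 2) / Y ^+ 2).
Proof.
have H := jet2X 0 (jet2B (jet2_sqr_shift y 0) (jet2_cst (Y ^+ 2))).
apply: (jet2_ext (f := fun t => Y ^- 2 * ((y + t - 0) ^+ 2 - Y ^+ 2) ^+ 2)) => [t|].
  by rewrite /bowl subr0 mulrC.
by apply: (jet2_eq (jet2Z (Y ^- 2) H)); rewrite /bowl !subr0 ?expr1 ?expr0; ring.
Qed.

Lemma bowlE Y y : 0 < Y -> bowl Y y = (y - Y) ^+ 2 * ((y + Y) / Y) ^+ 2.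
Proof. by move=> Y0; rewrite /bowl; field; rewrite gt_eqF. Qed.

Lemma bowl_ge Y y : 0 < Y -> 0 <= y -> (y - Y) ^+ 2 <= bowl Y y.
Proof.
move=> Y0 y0; rewrite bowlE// ler_peMr ?sqr_ge0// exprn_ege1//.
by rewrite ler_pdivlMr// mul1r lerDr.
Qed.

Lemma bowl_ge0 Y y : 0 <= bowl Y y.
Proof. by rewrite /bowl divr_ge0 ?sqr_ge0. Qed.

Lemma bowl_grad Y y : 0 < Y ->
  (4 * y * (y ^+ 2 - Y ^+ 2) / Y ^+ 2) ^+ 2 = 16 * (y ^+ 2 / Y ^+ 2) * bowl Y y.
Proof. by move=> Y0; rewrite /bowl; field; rewrite gt_eqF. Qed.

(** Evenness puts a factor y in the slope, which cancels the singularity of c / y. What remains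
    tends to -4 (c + 1) < 0 at the edge. *)
Lemma bowl_drift Y y : 0 < Y -> 0 < y ->
  (12 * y ^+ 2 - 4 * Y ^+ 2) / Y ^+ 2 + c / y * (4 * y * (y ^+ 2 - Y ^+ 2) / Y ^+ 2)
  = (12 + 4 * c) * (y ^+ 2 / Y ^+ 2) - 4 * (c + 1).
Proof. by move=> Y0 y0; field; rewrite !gt_eqF. Qed.

Lemma bowl_ratio Y y K : 1 <= Y -> 1 <= K -> bowl Y y <= K ->
  y ^+ 2 / Y ^+ 2 <= 1 + K.
Proof.
move=> Y1 K1 hK; have Y0 : 0 < Y by rewrite (lt_le_trans ltr01).
rewrite -lerBlDl leNgt; apply/negP => h.
suff : K < bowl Y y by rewrite ltNge hK.
have -> : bowl Y y = Y ^+ 2 * (y ^+ 2 / Y ^+ 2 - 1) ^+ 2.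
  by rewrite /bowl; field; rewrite gt_eqF.
apply: (@lt_le_trans _ _ ((y ^+ 2 / Y ^+ 2 - 1) ^+ 2)); last first.
  by rewrite ler_peMl ?sqr_ge0// exprn_ege1.
apply: (lt_le_trans h); rewrite expr2 ler_peMl//; lra.
Qed.

(* Near y = 0 the drift makes [K - lam |x|^2 - bowl Y y] itself a strict
   subsolution, since its y-minimum there is very convex for small [lam];
   elsewhere its gradient is bounded below off the unit box, so that a high
   power of it is a subsolution. *)
Lemma box_growth : exists2 kap : R, 0 < kap & forall u (Y m : R), sol L u ->
  (forall z, 0 <= z.2 -> 0 <= u z) -> 1 <= Y -> 0 < m ->
  (forall z, `|z.1| <= 1 -> `|z.2 - Y| <= 1 -> m <= u z) ->
  forall z, `|z.1| <= 5 -> `|z.2 - Y| <= 5 -> 0 <= z.2 -> kap * m <= u z.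
Proof.
have c1 := drift_gt L; have v0 := vweight_gt0 L; have w0 := hweight_gt0 L.
pose D := 12 + 4 * c; have D0 : 0 < D by rewrite /D; lra.
(* Small enough that 2 lam N <= c + 1: the horizontal Laplacian then cannot offset the term -4 (c +
   1) of the bowl. *)
pose lam := Num.min 1 ((c + 1) / (2 * N%:R + 1)).
have N0 : 0 < 2 * N%:R + 1 :> R by rewrite ltr_wpDl// mulr_ge0.
have lam0 : 0 < lam by rewrite lt_min ltr01 divr_gt0.
have lam1 : lam <= 1 by rewrite ge_min lexx.
have lamN : 2 * lam * N%:R <= c + 1.
  have : lam * (2 * N%:R + 1) <= c + 1.
    by rewrite -ler_pdivlMr// /lam ge_min lexx orbT.
  clear -lam0; lra.
(* On the target box lam |x|^2 <= 25 N, and the bowl is at most 25 * 49 because (y + Y) / Y <= 7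
   there; one more unit gives K - Q >= 1. *)
pose K : R := 25 * N%:R + 1226; have K1 : 1 < K.
  by rewrite /K ltr_wpDl ?mulr_ge0// ltr1n.
have K0 : 0 < K by rewrite (lt_trans ltr01).
(* Threshold for (y / Y)^2. Below it D (y / Y)^2 <= c + 1 and the drift alone suffices; above it the
   vertical slope is controlled from below by the bowl. *)
pose del := (c + 1) / D; have del0 : 0 < del by rewrite divr_gt0.
have delD : D * del = c + 1 by rewrite /del mulrCA divff ?mulr1// gt_eqF.
(* Above the threshold the gradient energy is at least b1 Q, and Q >= lam off the unit box. The
   choice of n then makes (n + 1) b1 lam exceed K C1, a bound for (K - Q) L(Q). *)
pose b1 := Num.min (4 * hweight L * lam) (16 * vweight L * del).
have b10 : 0 < b1 by rewrite lt_min; apply/andP; split; do 2?apply: mulr_gt0 => //.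
pose C1 := c + 1 + D * (1 + K).
have C10 : 0 < C1 by rewrite /C1 addr_gt0// mulr_gt0// addr_gt0.
have [n nE] := exists_nat_gt (K * C1 / (b1 * lam)).
rewrite ltr_pdivrMr ?mulr_gt0// in nE.
exists ((1 / K) ^+ n.+2); first by rewrite exprn_gt0// divr_gt0.
move=> u Y m us u0 Y1 m0 um; have Y0 : 0 < Y by rewrite (lt_le_trans ltr01).
pose Q := quad (N := N) lam (bowl Y).
have QE z : Q z = lam * sqsum z.1 + bowl Y z.2 by [].
have Q0 z : 0 <= Q z by rewrite QE addr_ge0 ?bowl_ge0// mulr_ge0 ?sqsum_ge0// ltW.
pose w z := m / K ^+ n.+2 * (K - Q z) ^+ n.+2.
have wc : continuous w by apply: barrier_continuous; exact: bowl_continuous.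
have Qc : continuous Q by apply: quad_continuous; exact: bowl_continuous.
pose box := [set z : pt | `|z.1| <= 1] `&` [set z | `|z.2 - Y| <= 1].
pose K0s := [set z : pt | Q z <= K] `&` [set z | - z.2 <= 0].
pose E := [set z : pt | Q z < K] `&` ~` box.
have yYc : continuous (fun z : pt => `|z.2 - Y|).
  move=> z; have yc : t.2 - Y @[t --> z] --> z.2 - Y.
    by apply: cvgB; [exact: snd_continuous|exact: cvg_cst].
  exact: (cvg_comp _ _ yc (@norm_continuous _ _ (z.2 - Y))).
have K0sy z : K0s z -> 0 <= z.2 by move=> [_ /=]; rewrite oppr_le0.
have Qbig z : ~ box z -> 0 <= z.2 -> lam <= Q z.
  move=> nb z0; rewrite QE; have [x1|x1] := leP `|z.1| 1; last first.
    have : lam * 1 <= lam * sqsum z.1.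
      rewrite ler_wpM2l ?(ltW lam0)//; apply: le_trans (sqsum_ge _).
      by rewrite exprn_ege1// ltW.
    by have := bowl_ge0 Y z.2; clear; lra.
  have : 1 <= `|z.2 - Y| by rewrite leNgt; apply/negP => /ltW y1; apply: nb.
  move=> /(exprn_ege1 2); rewrite real_normK ?num_real// => y1.
  have := bowl_ge Y0 z0; have := mulr_ge0 (ltW lam0) (sqsum_ge0 z.1).
  by clear -y1 lam1; lra.
have sqn (x : 'rV[R]_N) : `|x| <= 1 + sqsum x.
  have := sqsum_ge x; have := sqr_ge0 (`|x| - 1); have := normr_ge0 x; clear; nra.
have sqy (y : R) : `|y| <= 1 + y ^+ 2.
  have := sqr_ge0 (`|y| - 1); have := normr_ge0 y.
  by rewrite -[y ^+ 2]real_normK ?num_real//; clear; nra.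
move=> z z1 z2 z3.
have low : 1 <= K - Q z.
  have S1 : lam * sqsum z.1 <= 25 * N%:R.
    apply: le_trans (_ : 1 * sqsum z.1 <= _); first by rewrite ler_wpM2r ?sqsum_ge0.
    by rewrite mul1r; have := sqsum_le z1; clear; lra.
  have B1 : bowl Y z.2 <= 25 * 49.
    rewrite bowlE//; apply: ler_pM; rewrite ?sqr_ge0//.
      rewrite -[leLHS]real_normK ?num_real// (_ : 25 = 5 ^+ 2); last by ring.
      by rewrite lerXn2r ?nnegrE.
    rewrite (_ : 49 = 7 ^+ 2); last by ring.
    rewrite lerXn2r ?nnegrE ?ler_pdivrMr ?divr_ge0// ?addr_ge0// ?(ltW Y0)//.
    by move: z2; rewrite ler_norml => /andP[_]; clear -Y1; lra.
  rewrite QE /K; clear -S1 B1; lra.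
have zK : K0s z by split=> /=; [clear -low; lra|rewrite oppr_le0].
apply: (@le_trans _ _ (w z)); first by apply: barrier_ge; rewrite ?low ?ltW.
move: z zK {z1 z2 z3 low}; apply: (minimum_principle (E := E) us wc) => //.
- apply: (subclosed_compact _ (@compact_slab R N (1 + K / lam) 0 (Y + (1 + K)))).
    apply: closedI; apply: closed_sublevel => // z.
    by apply: cvgN; exact: snd_continuous.
  move=> z zK; have z0 := K0sy z zK; have [/= zQ _] := zK; rewrite QE in zQ; split.
    apply: le_trans (sqn _) _; rewrite lerD2l ler_pdivlMr// mulrC.
    by have := bowl_ge0 Y z.2; clear -zQ; lra.
  rewrite z0 /= -lerBlDl; apply: le_trans (ler_norm _) _.
  apply: le_trans (sqy _) _; rewrite lerD2l.
  have := bowl_ge Y0 z0; have := mulr_ge0 (ltW lam0) (sqsum_ge0 z.1).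
  by clear -zQ; lra.
- apply: openI; first exact: open_sublevel.
  by apply: closed_openC; apply: closedI; apply: closed_sublevel => //; exact: norm1_continuous.
- by move=> z [/= zQ _] z0; split; [exact: ltW|rewrite /= oppr_le0].
- move=> z zK nE'; have [/= zQ _] := zK; have z0 := K0sy z zK.
  move: zQ; rewrite le_eqVlt => /orP[/eqP zQ|zQ].
    by rewrite /w zQ subrr expr0n mulr0 u0.
  have [zb1 zb2] : box z by apply: contrapT => zb; apply: nE'.
  apply: le_trans (um z zb1 zb2); apply: barrier_le; rewrite ?(ltW m0)//.
  by rewrite subr_ge0 (ltW zQ) gerBl Q0.
- move=> z [/= zQ nb] z0.
  apply: (barrier_subsol _ _ (jet2_bowl Y z.2)) => //.
    by rewrite divr_gt0// exprn_gt0.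
  rewrite -/Q; have G0 : 0 < K - Q z by rewrite subr_gt0.
  have GK : K - Q z <= K by rewrite gerBl.
  have gle := gquad_norm_ge L lam (4 * z.2 * (z.2 ^+ 2 - Y ^+ 2) / Y ^+ 2) z.
  rewrite bowl_grad// -[_ + _ / _ + _]addrA bowl_drift// -/D.
  set sg := z.2 ^+ 2 / Y ^+ 2.
  have sg0 : 0 <= sg by rewrite divr_ge0 ?sqr_ge0.
  have h1 : 0 <= 4 * hweight L * lam ^+ 2 * sqsum z.1.
    by rewrite mulr_ge0 ?sqsum_ge0// mulr_ge0 ?sqr_ge0// mulr_ge0// ltW.
  have h2 : 0 <= vweight L * (16 * sg * bowl Y z.2).
    by rewrite mulr_ge0 ?(ltW v0)// mulr_ge0 ?bowl_ge0// mulr_ge0.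
  have n1 : 0 <= n.+1%:R :> R by [].
  have [sd|sd] := ltP sg del.
    have Dsg : D * sg <= c + 1 by rewrite -delD ler_wpM2l// ltW.
    have P0 : 2 * lam * N%:R + (D * sg - 4 * (c + 1)) < 0 by clear -Dsg lamN c1; lra.
    have := mulr_ge0 n1 (addr_ge0 h1 h2).
    have := ltr_pM2l G0 (2 * lam * N%:R + (D * sg - 4 * (c + 1))) 0.
    by rewrite P0 mulr0 => {}P0; clear -P0; lra.
  have bQ : bowl Y z.2 <= K.
    apply: le_trans (ltW zQ); rewrite QE lerDr mulr_ge0 ?sqsum_ge0//; exact: ltW.
  have sK : sg <= 1 + K := bowl_ratio Y1 (ltW K1) bQ.
  have P1 : 2 * lam * N%:R + (D * sg - 4 * (c + 1)) <= C1.
    have := ler_wpM2l (ltW D0) sK; rewrite /C1; clear -lamN c1; lra.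
  have GP : (K - Q z) * (2 * lam * N%:R + (D * sg - 4 * (c + 1))) <= K * C1.
    apply: le_trans (ler_wpM2l (ltW G0) P1) _.
    by rewrite ler_wpM2r// ltW.
  have b1Q : b1 * lam <= 4 * hweight L * lam ^+ 2 * sqsum z.1
      + vweight L * (16 * sg * bowl Y z.2).
    apply: le_trans (ler_wpM2l (ltW b10) (Qbig z nb (ltW z0))) _.
    rewrite QE mulrDr; apply: lerD.
      rewrite mulrA ler_wpM2r ?sqsum_ge0// expr2 mulrA ler_wpM2r ?(ltW lam0)//.
      by rewrite /b1 ge_min lexx.
    rewrite mulrA ler_wpM2r ?bowl_ge0//.
    apply: (@le_trans _ _ (16 * vweight L * del)); first by rewrite /b1 ge_min lexx orbT.
    by rewrite [leRHS]mulrCA mulrA ler_wpM2l// mulr_ge0// ltW.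
  have := ler_wpM2l n1 b1Q; clear -GP nE; lra.
- move=> x _; apply: barrier_edge.
  have := jet2_bowl Y 0; rewrite mulr0 !mul0r => bj.
  by apply: (jet2_ext (f := fun t => bowl Y (0 + t))) bj => t; rewrite add0r.
Qed.

End BoxGrowth.

(** * Interior regularity *)

Section HorizontalLipschitz.
Context {R : realType} {N : nat} (L : coefs R N).
Local Notation pt := ('rV[R]_N * R)%type.
Local Notation c := (drift L).
Implicit Types (u : pt -> R) (z : pt).

Definition hshift (k : 'I_N) (t : R) z : pt := (z.1 + t *: delta_mx ord0 k, z.2).

Lemma step0 z (d : pt) : step z d 0 = z.
Proof. by rewrite /step scale0r mul0r !addr0 -surjective_pairing. Qed.

Lemma hshift_step k t s z (d : pt) :
  hshift k t (step z d s) = step (hshift k t z) d s.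
Proof. by rewrite /hshift /step /= addrAC. Qed.

Lemma hshiftD k t s z :
  hshift k (t + s) z = step (hshift k t z) (dir L (Some (k, false))) s.
Proof. by rewrite /hshift /step /= mulr0 addr0 scalerDl addrA. Qed.

(* Reflection coupling in the direction e_k alone: both points of a pair then
   keep the same height, so the singular drifts cancel. *)
Lemma horizontal_lip : exists2 A : R, 0 < A & forall u (y1 : R) (k : 'I_N),
  sol L u -> 1 <= y1 ->
  (forall z, `|z.1| <= 1 / 4 -> `|z.2 - y1| <= 1 / 4 -> 0 <= u z <= 1) ->
  forall t : R, 0 <= t <= 1 / 8 ->
    u (hshift k t (0, y1)) - u (hshift k (- t) (0, y1)) <= A * t.
Proof.
have w0 := hweight_gt0 L.
(* Chosen so that 2 [hweight] B exceeds 128 (N + 1) + 32 |c|, an upper bound for the operator on [F]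
   in the region considered. *)
pose B := (64 * (N%:R + 1) + 16 * `|c| + 1) / hweight L.
have BE : B * hweight L = 64 * (N%:R + 1) + 16 * `|c| + 1 by rewrite divfK// gt_eqF.
have B0 : 0 < B.
  by rewrite divr_gt0// ltr_wpDl// addr_ge0// mulr_ge0// addr_ge0.
(* With this choice A t - B t^2 = 8 t + B t (1/8 - t), which is nonnegative on [0, 1/8] and equals 1
   at t = 1/8, the largest possible gap between two values of [u]. *)
pose A := 8 + B / 8; have A0 : 0 < A by rewrite /A; clear -B0; lra.
exists A => // u y1 k [uc uL _] y11 u01 t0 /andP[t00 t08].
pose kk : option ('I_N * bool) := Some (k, false).
pose h (y : R) := 64 * (y - y1) ^+ 2.
pose F := quad (N := N) 64 h.
have FE z : F z = 64 * (sqsum z.1 + (z.2 - y1) ^+ 2) by rewrite /F /quad /h mulrDr.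
have hj y : jet2 (fun s => h (y + s)) (h y) (128 * (y - y1)) 128.
  by apply: (jet2_eq (jet2Z 64 (jet2_sqr_shift y y1))) => //; ring.
have hc : continuous h.
  move=> y; apply: cvgM; first exact: cvg_cst.
  have yc : y - y1 @[y --> y] --> y - y1.
    by apply: cvgB; [exact: cvg_id|exact: cvg_cst].
  exact: (cvg_comp _ _ yc (@exprn_continuous _ 2 _)).
(* The coupled points are z + t e_k and z - t e_k. A negative minimum of [f] is interior: [F] is at
   least 1 on the sides, the concave term is 1 at t = 1/8, and the two points coincide at t = 0. *)
pose f (p : pt * R) := F p.1 + (A * p.2 - B * p.2 ^+ 2)
  - (u (hshift k p.2 p.1) - u (hshift k (- p.2) p.1)).
pose K0 := [set z : pt | `|z.1| <= 1 / 8 /\ y1 - 1 / 8 <= z.2 <= y1 + 1 / 8]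
  `*` `[0, 1 / 8 : R].
have K0c : compact K0 by apply: compact_setX; [exact: compact_slab|exact: segment_compact].
have hsc (s : R) : continuous (fun p : pt * R => hshift k (s * p.2) p.1).
  move=> p; have q1 : q.1 @[q --> p] --> p.1 by exact: cvg_fst.
  have q2 : q.2 @[q --> p] --> p.2 by exact: cvg_snd.
  have q11 : q.1.1 @[q --> p] --> p.1.1 := cvg_comp _ _ q1 (@fst_continuous R N p.1).
  have q12 : q.1.2 @[q --> p] --> p.1.2 := cvg_comp _ _ q1 (@snd_continuous R N p.1).
  have sq2 : s * q.2 @[q --> p] --> s * p.2 by apply: cvgM; [exact: cvg_cst|exact: q2].
  have c1 : q.1.1 + (s * q.2) *: delta_mx ord0 k @[q --> p]
      --> p.1.1 + (s * p.2) *: delta_mx ord0 k.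
    by apply: cvgD; [exact: q11|apply: cvgZr_tmp].
  exact: (cvg_pair c1 q12).
have fc : continuous f.
  move=> p; have c1 : q.1 @[q --> p] --> p.1 by exact: cvg_fst.
  have c2 : q.2 @[q --> p] --> p.2 by exact: cvg_snd.
  have Fc : continuous F by exact: quad_continuous.
  have a1 : F q.1 @[q --> p] --> F p.1 := cvg_comp _ _ c1 (Fc p.1).
  have a2 : A * q.2 - B * q.2 ^+ 2 @[q --> p] --> A * p.2 - B * p.2 ^+ 2.
    apply: cvgB; apply: cvgM; try exact: cvg_cst; first exact: c2.
    exact: (cvg_comp _ _ c2 (@exprn_continuous _ 2 _)).
  have a3 : u (hshift k q.2 q.1) @[q --> p] --> u (hshift k p.2 p.1).
    move: (hsc 1); rewrite (_ : (fun _ => _) = (fun q : pt * R => hshift k q.2 q.1)) => [H|].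
      exact: (cvg_comp _ _ (H p) (uc (hshift k p.2 p.1))).
    by apply/funext => q; rewrite mul1r.
  have a4 : u (hshift k (- q.2) q.1) @[q --> p] --> u (hshift k (- p.2) p.1).
    move: (hsc (-1)); rewrite (_ : (fun _ => _) = (fun q : pt * R => hshift k (- q.2) q.1)) => [H|].
      exact: (cvg_comp _ _ (H p) (uc (hshift k (- p.2) p.1))).
    by apply/funext => q; rewrite mulN1r.
  exact: (cvgB (cvgD a1 a2) (cvgB a3 a4)).
have Kt0 : K0 ((0, y1), t0).
  split=> /=; last by rewrite in_itv/= t00.
  by rewrite normr0; split; [|apply/andP; split]; clear -y11; lra.
rewrite leNgt; apply/negP => bad.
have [[z t]] : exists2 p, p \in K0 & forall q, q \in K0 -> f p <= f q.
  by apply: compact_EVT_min; [exists ((0, y1), t0)| |exact: continuous_subspaceT].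
rewrite inE => -[[/= z1 z2]]; rewrite in_itv/= => t1 fmin.
have {}fmin q : K0 q -> f (z, t) <= f q by move=> ?; apply: fmin; rewrite inE.
have fneg : f (z, t) < 0.
  apply: le_lt_trans (fmin _ Kt0) _; rewrite /f /= FE /=.
  have -> : sqsum (0 : 'rV[R]_N) = 0 by rewrite /sqsum big1// => i _; rewrite mxE expr0n.
  rewrite subrr expr0n /= addr0 mulr0 add0r.
  have := mulr_ge0 (ltW B0) (sqr_ge0 t0); clear -bad; lra.
have nk : `|delta_mx ord0 k : 'rV[R]_N| <= 1.
  apply: normr_row_le => // i; rewrite mxE eqxx /=.
  by case: (_ == _); rewrite ?normr1 ?normr0.
have tn : `|t| <= 1 / 8 by case/andP: t1 => ? ?; rewrite ger0_norm.
have inbox (s : R) : `|s| <= 1 / 8 -> 0 <= u (hshift k s z) <= 1.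
  move=> s1; apply: u01 => /=.
    apply: le_trans (ler_normD _ _) _; rewrite normrZ.
    have := ler_pM (normr_ge0 s) (normr_ge0 _) s1 nk.
    by rewrite mulr1; clear -z1; lra.
  by case/andP: z2 => h1 h2; rewrite ler_norml; apply/andP; split; clear -h1 h2; lra.
have ud : u (hshift k t z) - u (hshift k (- t) z) <= 1.
  have := inbox t tn; have := inbox (- t); rewrite normrN => /(_ tn).
  by move=> /andP[h1 _] /andP[_ h2]; clear -h1 h2; lra.
have At : 0 <= A * t - B * t ^+ 2.
  rewrite (_ : _ - _ = 8 * t + B * (t * (1 / 8 - t))); last by rewrite /A; field.
  case/andP: t1 => h1 h2.
  apply: addr_ge0; first by rewrite mulr_ge0.
  by apply: mulr_ge0 (ltW B0) _; rewrite mulr_ge0// subr_ge0.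
have := fneg; rewrite {1}/f /= FE => fneg'.
have S0 := sqsum_ge0 z.1; have Y0 := sqr_ge0 (z.2 - y1).
have z1s : `|z.1| < 1 / 8.
  rewrite lt_neqAle z1 andbT; apply/eqP => z1E.
  have := sqsum_ge z.1; rewrite z1E => S1; clear -fneg' ud At S1 Y0; nra.
have z2s : y1 - 1 / 8 < z.2 < y1 + 1 / 8.
  case/andP: (z2) => h1 h2; apply/andP; split; rewrite lt_neqAle ?h1 ?h2 andbT; apply/eqP => zE.
    by move: fneg'; rewrite -zE; clear -ud At S0; nra.
  by move: fneg'; rewrite zE; clear -ud At S0; nra.
have ts : 0 < t < 1 / 8.
  case/andP: (t1) => h1 h2; apply/andP; split; rewrite lt_neqAle ?h1 ?h2 andbT; apply/eqP => tE.
    by move: fneg'; rewrite -tE oppr0 subrr expr0n /= !mulr0 subrr addr0; clear -S0 Y0; lra.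
  move: fneg' ud; rewrite tE; set d := u _ - u _; rewrite /A; clear -S0 Y0; nra.
have y0 : 0 < z.2 by case/andP: z2s => h1 _; clear -h1 y11; lra.
have [gp [Hp [pj Lp]]] := uL (hshift k t z) y0.
have [gq [Hq [qj Lq]]] := uL (hshift k (- t) z) y0.
have Fj : jets L F z _ _ := jets_quad L 64 (hj z.2).
set gF := gquad _ _ _ _ in Fj; set HF := Hquad _ _ _ in Fj.
(* Variation of z with t fixed: both points move in parallel along each direction. *)
have cmp j : gp j - gq j = gF j /\ Hp j - Hq j <= HF j.
  have := jet2B (Fj j) (jet2B (pj j) (qj j)) => J.
  have [|h1 h2] := jet2_min J; last by split; [clear -h1|clear -h2]; lra.
  have sc := @step_cvg R N z (dir L j).
  have n1 : \forall s \near (0 : R), `|(step z (dir L j) s).1| < 1 / 8.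
    exact: (cvg_comp _ _ sc (@norm1_continuous R N z) _ (lt_nbhsl z1s)).
  have c2 := cvg_comp _ _ sc (@snd_continuous R N z).
  case/andP: z2s => z21 z22.
  have n2 : \forall s \near (0 : R), y1 - 1 / 8 < (step z (dir L j) s).2.
    exact: (c2 _ (lt_nbhsr z21)).
  have n3 : \forall s \near (0 : R), (step z (dir L j) s).2 < y1 + 1 / 8.
    exact: (c2 _ (lt_nbhsl z22)).
  apply: filterS3 n1 n2 n3 => s h1 h2 h3.
  have KS : K0 (step z (dir L j) s, t).
    by split=> /=; [split; [exact: ltW|rewrite !ltW]|rewrite in_itv].
  have := fmin _ KS; rewrite /f /= !hshift_step !step0; clear; lra.
(* Variation of t: the points move oppositely along e_k. The second-order terms of [u] are the same
   as for a parallel move, but they now face the concave term, whose second derivative is -2 B. This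
   replaces the bound of [cmp] at the single index [kk]. *)
have cmpk : Hp kk - Hq kk <= - (2 * B).
  have J1 : jet2 (fun s => A * (t + s) - B * (t + s) ^+ 2)
      (A * t - B * t ^+ 2) (A - B * (2 * t)) (- (2 * B)).
    have := jet2B (jet2_affine (A * t) A) (jet2Z B (jet2_sqr_shift t 0)).
    rewrite subr0 => /jet2_eq J1.
    apply: (jet2_ext (f := fun s => A * t + A * s - B * (t + s - 0) ^+ 2)).
      by move=> s; ring.
    by apply: J1 => //; ring.
  have J := jet2B J1 (jet2B (pj kk) (jet2_scale (-1) (qj kk))).
  have [|_ h2] := jet2_min J; last by clear -h2; lra.
  case/andP: ts => ts0 ts1.
  have tc : t + s @[s --> (0 : R)] --> t.
    by rewrite -[X in _ --> X]addr0; apply: cvgD; [exact: cvg_cst|exact: cvg_id].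
  have n1 : \forall s \near (0 : R), 0 < t + s by exact: (tc _ (lt_nbhsr ts0)).
  have n2 : \forall s \near (0 : R), t + s < 1 / 8 by exact: (tc _ (lt_nbhsl ts1)).
  apply: filterS2 n1 n2 => s h1 h2.
  have KS : K0 (z, t + s) by split=> //=; rewrite in_itv/= !ltW.
  have := fmin _ KS; rewrite /f /= (opprD t s) !hshiftD -/kk !mulN1r oppr0 !step0 addr0.
  by clear; lra.
have LF := Lop_quad L 64 (128 * (z.2 - y1)) 128 z.2 z.
rewrite -/gF -/HF /Lop in LF.
have : \sum_k0 weight L k0 * (Hp k0 - Hq k0) <= \sum_k0 weight L k0 * HF k0
    - hweight L * HF kk - hweight L * (2 * B).
  rewrite (bigD1 kk)//= [X in _ <= X - _ - _](bigD1 kk)//=.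
  have h1 := ler_wpM2l (ltW w0) cmpk; rewrite mulrN in h1.
  set S1 := \sum_(_ | _) _; set S2 := \sum_(_ | _) _.
  have h2 : S1 <= S2.
    by apply: ler_sum => j _; rewrite ler_wpM2l ?weight_ge0//; case: (cmp j).
  by move: h1 h2; clear; lra.
have -> : \sum_k0 weight L k0 * (Hp k0 - Hq k0) = - (c / z.2 * gF None).
  move: Lp Lq; rewrite /Lop -(proj1 (cmp None)).
  under [in X in _ -> _ -> X = _]eq_bigr do rewrite mulrBr.
  by rewrite sumrB /=; clear; lra.
have HF0 : 0 <= hweight L * HF kk.
  by rewrite mulr_ge0 ?(ltW w0)// /HF /Hquad /= expr0n /= mul0r addr0 mulr_ge0.
have cB : c / z.2 * (128 * (z.2 - y1)) <= 32 * `|c|.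
  apply: (le_trans (ler_norm _)); rewrite !normrM normfV.
  rewrite -mulrA [leRHS]mulrC ler_wpM2l// (gtr0_norm y0) mulrC ler_pdivrMr//.
  have : `|z.2 - y1| <= 1 / 8.
    case/andP: z2s => h1 h2; rewrite ler_norml; apply/andP; split; clear -h1 h2; lra.
  case/andP: z2s => h1 _; rewrite ger0_norm//; clear -h1 y11; lra.
move: LF BE HF0 cB; clear; lra.
Qed.

End HorizontalLipschitz.

(** * From one large value to a ball of comparable values *)

Section InteriorSpread.
Context {R : realType} {N : nat} (L : coefs R N).
Local Notation pt := ('rV[R]_N * R)%type.
Implicit Types (u : pt -> R) (z : pt).

Lemma sol_translate u (x0 : 'rV[R]_N) : sol L u -> sol L (fun z => u (x0 + z.1, z.2)).
Proof.
move=> /(sol_dilate x0 (ltr01 (R := R))).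
by rewrite (_ : (fun _ => _) = (fun z => u (x0 + z.1, z.2)))//; apply/funext => z;
  rewrite scale1r mul1r.
Qed.

(** [horizontal_lip] treats one coordinate, a symmetric pair of points and one sign. The opposite
    sign comes from 1 - u; the general case from switching on the coordinates of x one at a time,
    each switch being a symmetric pair about its midpoint. *)
Lemma horizontal_osc : exists2 A : R, 0 < A & forall u (y1 : R),
  sol L u -> 1 <= y1 ->
  (forall z, `|z.1| <= 1 / 2 -> `|z.2 - y1| <= 1 / 2 -> 0 <= u z <= 1) ->
  forall x : 'rV[R]_N, `|x| <= 1 / 8 -> `|u (x, y1) - u (0, y1)| <= A * `|x|.
Proof.
have [A A0 lip] := horizontal_lip L.
(* [N.+1] rather than N keeps the constant positive when N = 0. *)
exists (N.+1%:R * A); first by rewrite mulr_gt0.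
move=> u y1 us y11 u01 x x8.
have lip1 v (k : 'I_N) (xb : 'rV[R]_N) (t : R) : sol L v ->
    (forall z, `|z.1| <= 1 / 2 -> `|z.2 - y1| <= 1 / 2 -> 0 <= v z <= 1) ->
    `|xb| <= 1 / 4 -> 0 <= t <= 1 / 8 ->
    v (xb + t *: delta_mx ord0 k, y1) - v (xb - t *: delta_mx ord0 k, y1) <= A * t.
  move=> vs v01 xb4 t8; have := lip _ y1 k (sol_translate xb vs) y11 _ t t8.
  rewrite /hshift /= !add0r scaleNr; apply => z z1 z2; apply: v01 => /=.
    by apply: le_trans (ler_normD _ _) _; clear -z1 xb4; lra.
  by clear -z2; lra.
have lip2 (k : 'I_N) (xb : 'rV[R]_N) (t : R) : `|xb| <= 1 / 4 -> `|t| <= 1 / 8 ->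
    `|u (xb + t *: delta_mx ord0 k, y1) - u (xb - t *: delta_mx ord0 k, y1)| <= A * `|t|.
  move=> xb4 t8.
  wlog t0 : t t8 / 0 <= t => [H|].
    have [t0|t0] := leP 0 t; first exact: H.
    have := H (- t); rewrite normrN scaleNr opprK distrC; apply => //.
    by rewrite oppr_ge0 ltW.
  rewrite (ger0_norm t0) in t8 *.
  have tt : 0 <= t <= 1 / 8 by rewrite t0.
  rewrite ler_norml lip1// andbT.
  have us' := sol_affine (-1) 1 us.
  have H : (-1 * u (xb + t *: delta_mx ord0 k, y1) + 1)
      - (-1 * u (xb - t *: delta_mx ord0 k, y1) + 1) <= A * t.
    apply: (lip1 (fun z => -1 * u z + 1)) => // z z1 z2.
    by have /andP[h1 h2] := u01 z z1 z2; apply/andP; split; clear -h1 h2; lra.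
  clear -H; lra.
pose tr (j : nat) : 'rV[R]_N := \row_i (if (i < j)%N then x ord0 i else 0).
have trn j : `|tr j| <= `|x|.
  apply: normr_row_le => // i; rewrite mxE; case: ifP => _; first exact: normr_coord.
  by rewrite normr0.
have trS (j : 'I_N) : tr j.+1 = tr j + x ord0 j *: delta_mx ord0 j.
  apply/rowP => i; rewrite !mxE eqxx /= ltnS leq_eqVlt.
  have [ij|ij] := eqVneq (i : nat) j.
    have -> : i = j by exact: val_inj.
    by rewrite eqxx ltnn mulr1 add0r.
  rewrite (_ : i == j = false) ?mulr0 ?addr0//.
  by apply/negP => /eqP ijE; move: ij; rewrite ijE eqxx.
have steps j : (j <= N)%N -> `|u (tr j, y1) - u (tr 0%N, y1)| <= j%:R * (A * `|x|).
  elim: j => [|j IH] jN; first by rewrite subrr normr0 mul0r.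
  have := IH (ltnW jN) => {}IH.
  have xj : `|x ord0 (Ordinal jN) / 2| <= `|x| / 2.
    by rewrite normrM (ger0_norm (_ : 0 <= 2^-1))// ler_pM2r// normr_coord.
  pose t := x ord0 (Ordinal jN) / 2; rewrite -/t in xj.
  pose xb := tr j + t *: delta_mx ord0 (Ordinal jN).
  have nk : `|delta_mx ord0 (Ordinal jN) : 'rV[R]_N| <= 1.
    apply: normr_row_le => // i; rewrite mxE eqxx /=.
    by case: (_ == _); rewrite ?normr1 ?normr0.
  have xb4 : `|xb| <= 1 / 4.
    apply: le_trans (ler_normD _ _) _; rewrite normrZ.
    have := ler_pM (normr_ge0 t) (normr_ge0 _) xj nk; rewrite mulr1.
    by have := trn j; clear -x8; lra.
  have t8 : `|t| <= 1 / 8 by clear -xj x8; have := normr_ge0 x; lra.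
  have := lip2 (Ordinal jN) xb t xb4 t8.
  rewrite /xb addrK -addrA -scalerDl -splitr -(trS (Ordinal jN)) => h1.
  have h2 : A * `|t| <= A * `|x|.
    rewrite ler_wpM2l ?(ltW A0)//; clear -xj; have := normr_ge0 x; lra.
  have := ler_normD (u (tr j.+1, y1) - u (tr j, y1)) (u (tr j, y1) - u (tr 0%N, y1)).
  rewrite addrA subrK -natr1; move: IH h1 h2; clear; lra.
have := steps N (leqnn N).
have -> : tr N = x by apply/rowP => i; rewrite mxE ltn_ord.
have -> : tr 0%N = 0 by apply/rowP => i; rewrite !mxE.
have := mulr_ge0 (ltW A0) (normr_ge0 x); rewrite -[N.+1%:R]natr1; clear; lra.
Qed.

(** After division by 2 M the solution takes values in [0, 1]. On a disc of radius e with A e <= 1/6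
    it thus varies by at most M / 3, so u >= M / 3 there, and [lens] applies. *)
Lemma interior_spread : exists kap rho : R, [/\ 0 < kap, 0 < rho <= 1 / 2 &
  forall u (y1 M : R), sol L u -> (forall z, 0 <= z.2 -> 0 <= u z) ->
  1 <= y1 -> 0 < M ->
  (forall z, `|z.1| <= 1 / 2 -> `|z.2 - y1| <= 1 / 2 -> u z <= 2 * M) ->
  2 / 3 * M <= u (0, y1) ->
  exists Y : R, [/\ `|Y - y1| <= 1 / 2, rho <= Y &
    forall z, `|z.1| <= rho -> `|z.2 - Y| <= rho -> kap * M <= u z]].
Proof.
have [A A0 osc] := horizontal_osc.
pose e := Num.min (1 / 8) (1 / (6 * A)).
have e0 : 0 < e by rewrite lt_min !divr_gt0// mulr_gt0.
have e8 : e <= 1 / 8 by rewrite ge_min lexx.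
have eA : A * e <= 1 / 6.
  rewrite mulrC -ler_pdivlMr// (_ : 1 / 6 / A = 1 / (6 * A)) ?ge_min ?lexx ?orbT//.
  by field; rewrite gt_eqF.
have e2 : e ^+ 2 <= 1 / 64.
  by rewrite (_ : 1 / 64 = (1 / 8) ^+ 2) ?lerXn2r ?nnegrE ?(ltW e0)//; field.
have [|kap kap0 spread] := lens L e0.
  by apply: le_trans e2 _; lra.
have N0 : 0 < 8 * N.+1%:R :> R by rewrite mulr_gt0.
have N1 : 1 <= 8 * N.+1%:R :> R by rewrite -natrM ler1n.
exists (kap * (1 / 3)), (e ^+ 2 / (8 * N.+1%:R)).
have rho0 : 0 < e ^+ 2 / (8 * N.+1%:R) by rewrite divr_gt0// exprn_gt0.
have rho1 : e ^+ 2 / (8 * N.+1%:R) <= 1 / 64.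
  by rewrite ler_pdivrMr// (le_trans e2)// ler_peMr.
split; [by rewrite mulr_gt0|by rewrite rho0 (le_trans rho1)//; lra|].
move=> u y1 M us u0 y11 M0 u2M uM.
have uc (x : 'rV[R]_N) : `|x| <= e -> 1 / 3 * M <= u (x, y1).
  move=> xe; have us' := sol_affine ((2 * M)^-1) 0 us.
  have M2 : 0 < 2 * M by rewrite mulr_gt0.
  have H : `|(2 * M)^-1 * u (x, y1) + 0 - ((2 * M)^-1 * u (0, y1) + 0)| <= A * `|x|.
    apply: (osc _ y1 us' y11) (le_trans xe e8) => z z1 z2; rewrite addr0 mulrC.
    have z0 : 0 <= z.2 by move: z2; rewrite ler_norml => /andP[h _]; clear -h y11; lra.
    by rewrite ler_pdivrMr// mul1r u2M// divr_ge0 ?u0// ltW.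
  have {}H : `|u (x, y1) - u (0, y1)| <= A * `|x| * (2 * M).
    rewrite -ler_pdivrMr// -[(2 * M)^-1]gtr0_norm ?invr_gt0// -normrM mulrC.
    by move: H; rewrite !addr0 -mulrBr.
  have h1 : A * `|x| <= 1 / 6 by apply: le_trans eA; rewrite ler_wpM2l ?(ltW A0).
  have h2 := ler_wpM2r (ltW M2) h1.
  move: H; rewrite ler_norml => /andP[h3 _]; clear -h2 h3 uM; lra.
have M3 : 0 < 1 / 3 * M by rewrite mulr_gt0// divr_gt0.
have e20 : 0 < e ^+ 2 by rewrite exprn_gt0.
exists (y1 - e ^+ 2 / 4); split.
- by rewrite addrAC subrr add0r normrN ger0_norm; clear -e2 e20; lra.
- by apply: le_trans rho1 _; clear -e2 y11; lra.
- move=> z z1 z2; rewrite -mulrA; exact: (spread u y1 _ us u0 y11 M3 uc z z1 z2).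
Qed.

End InteriorSpread.

(** * Harnack inequality *)

Section Harnack.
Context {R : realType} {N : nat} (L : coefs R N).
Local Notation pt := ('rV[R]_N * R)%type.
Implicit Types (u : pt -> R) (z : pt).

Definition near_pt (r : R) z0 z := `|z.1 - z0.1| <= r /\ `|z.2 - z0.2| <= r.

Definition nonneg_sol u := sol L u /\ forall z, 0 <= z.2 -> 0 <= u z.

Lemma nonneg_sol_dilate u (x0 : 'rV[R]_N) (r : R) : 0 < r -> nonneg_sol u ->
  nonneg_sol (fun z => u (x0 + r *: z.1, r * z.2)).
Proof.
by move=> r0 [us u0]; split=> [|z z0]; [exact: sol_dilate|rewrite u0 //= mulr_ge0// ltW].
Qed.

Lemma normr_dilate (V : normedModType R) (r s : R) (x y : V) : 0 < r ->
  (`|r^-1 *: (x - y)| <= s) = (`|x - y| <= s * r).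
Proof. by move=> r0; rewrite normrZ gtr0_norm ?invr_gt0// mulrC ler_pdivrMr. Qed.

Lemma dilateK (x0 : 'rV[R]_N) (r : R) z : r != 0 ->
  (x0 + r *: (r^-1 *: (z.1 - x0)), r * (r^-1 * z.2)) = z.
Proof.
move=> r0; rewrite scalerA mulfV// scale1r addrC subrK mulrA mulfV// mul1r.
by rewrite -surjective_pairing.
Qed.

(** Dilation reduces this to r = 1. At height at least 1 [interior_spread] applies at once. Below,
    [cylinder] first finds a value at least 2/3 M at height 1, which is why [interior_spread] starts
    from 2/3 M; the translate to that point needs the extra unit in Lam + 1. *)
Lemma spread : exists Lam kap rho : R, [/\ 2 <= Lam, 0 < kap, 0 < rho <= 1 / 2 &
  forall u z1 (r M : R), nonneg_sol u -> 0 <= z1.2 -> 0 < r -> 0 < M -> M <= u z1 ->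
  (forall z, near_pt (Lam * r) z1 z -> 0 <= z.2 -> u z <= 2 * M) ->
  exists z2, [/\ near_pt (Lam * r) z1 z2, rho * r <= z2.2 &
    forall z, near_pt (rho * r) z2 z -> kap * M <= u z]].
Proof.
have [Lam Lam1 cyl] := cylinder L; have [kap [rho [kap0 rho1 spr]]] := interior_spread L.
exists (Lam + 1), kap, rho; split=> //; first by clear -Lam1; lra.
have unit u (y1 M : R) : nonneg_sol u -> 0 <= y1 -> 0 < M -> M <= u (0, y1) ->
    (forall z, near_pt (Lam + 1) (0, y1) z -> 0 <= z.2 -> u z <= 2 * M) ->
    exists z2, [/\ near_pt (Lam + 1) (0, y1) z2, rho <= z2.2 &
      forall z, near_pt rho z2 z -> kap * M <= u z].
  move=> [us u0] y10 M0 uM u2M; have [y11|y11] := leP 1 y1.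
    have [z z1 z2||Y [Y1 Y2 Y3]] := spr u y1 M us u0 y11 M0.
    - apply: u2M; first by split=> /=; rewrite ?subr0; [clear -z1 Lam1|clear -z2 Lam1]; lra.
      by move: z2; rewrite ler_norml => /andP[h _]; clear -h y11; lra.
    - by clear -uM M0; lra.
    exists (0, Y); split=> //=.
    - by split=> /=; rewrite ?subr0 ?normr0; [clear -Lam1|clear -Y1 Lam1]; lra.
    - by move=> z [/= z1 z2]; apply: Y3 => //; rewrite subr0 in z1.
  have y1b : 0 <= y1 <= 1 by rewrite y10 ltW.
  have [z z1 /andP[z2 z3]|x xL xM] := cyl u M y1 us M0 y1b uM.
    apply: u2M => //; split=> /=; rewrite ?subr0; first by clear -z1; lra.
    by rewrite ler_norml; apply/andP; split; clear -z2 z3 y10 y11 Lam1; lra.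
  have u0' z : 0 <= z.2 -> 0 <= u (x + z.1, z.2) by move=> z0; exact: u0.
  have [z z1 z2||Y [Y1 Y2 Y3]] := spr _ 1 M (sol_translate x us) u0' (lexx _) M0.
  - have [h1 h2] : 1 / 2 <= z.2 /\ z.2 <= 3 / 2.
      by move: z2; rewrite ler_norml => /andP[h1 h2]; split; clear -h1 h2; lra.
    apply: u2M => /=; last by clear -h1; lra.
    split=> /=; first by rewrite subr0; apply: le_trans (ler_normD _ _) _; clear -z1 xL; lra.
    by rewrite ler_norml; apply/andP; split; clear -h1 h2 y10 y11 Lam1; lra.
  - by rewrite addr0.
  exists (x, Y); split=> //=.
  - split=> /=; first by rewrite subr0; clear -xL; lra.
    move: Y1; rewrite !ler_norml => /andP[h1 h2].
    by apply/andP; split; clear -h1 h2 y10 y11 Lam1; lra.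
  - move=> z [/= z1 z2]; have := Y3 (z.1 - x, z.2) z1 z2.
    by rewrite /= addrC subrK -surjective_pairing.
move=> u z1 r M us z10 r0 M0 uM u2M.
have r1 : r != 0 by rewrite gt_eqF.
have nr (y y' s : R) : (`|r^-1 * y - y'| <= s) = (`|y - r * y'| <= s * r).
  rewrite -[in LHS](mulKf r1 y') -mulrBr.
  exact: (@normr_dilate R^o r s y (r * y')).
have y0 : 0 <= r^-1 * z1.2 by rewrite mulr_ge0// invr_ge0 ltW.
have u1 : M <= u (z1.1 + r *: 0, r * (r^-1 * z1.2)).
  by rewrite scaler0 addr0 mulrA mulfV// mul1r -surjective_pairing.
have [z [/= h1 h2] z0|[x2 Y2] [[/= z21 z22] z2r z2M]] :=
  unit _ (r^-1 * z1.2) M (nonneg_sol_dilate z1.1 r0 us) y0 M0 u1.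
  apply: u2M => /=; last by rewrite mulr_ge0// ltW.
  split=> /=.
    rewrite addrC addKr normrZ gtr0_norm// mulrC ler_pM2r//.
    by rewrite subr0 in h1.
  by rewrite distrC -nr distrC.
exists (z1.1 + r *: x2, r * Y2); split=> //=.
- split=> /=; last by rewrite distrC -nr distrC.
  by rewrite addrC addKr normrZ gtr0_norm// mulrC ler_pM2r// -[x2]subr0.
- by rewrite mulrC ler_pM2l.
- move=> z [/= h1 h2]; rewrite -(dilateK z1.1 z r1); apply: (z2M (r^-1 *: (z.1 - z1.1), r^-1 * z.2)).
  split=> /=; last by rewrite nr.
  rewrite -[x2](scalerK r1) -scalerBr normr_dilate//.
  by rewrite -addrA -opprD.
Qed.

Lemma box_growth_at : exists2 kap : R, 0 < kap & forall u z1 (r m : R),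
  nonneg_sol u -> 0 < r -> r <= z1.2 -> 0 < m ->
  (forall z, near_pt r z1 z -> m <= u z) ->
  forall z, near_pt (5 * r) z1 z -> 0 <= z.2 -> kap * m <= u z.
Proof.
have [kap kap0 grow] := box_growth L.
exists kap => // u z1 r m us r0 rz1 m0 um z [/= h1 h2] z0.
have r1 : r != 0 by rewrite gt_eqF.
have [us' u0'] := nonneg_sol_dilate z1.1 r0 us.
have nr (y y' s : R) : (`|r^-1 * y - r^-1 * y'| <= s) = (`|y - y'| <= s * r).
  by rewrite -mulrBr; exact: (@normr_dilate R^o r s y y').
have := grow _ (r^-1 * z1.2) m us' u0' _ m0 _ (r^-1 *: (z.1 - z1.1), r^-1 * z.2).
rewrite /= nr normr_dilate// dilateK//; apply => //.
- by rewrite mulrC ler_pdivlMr// mul1r.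
- move=> t t1 t2; apply: um; split=> /=.
    by rewrite addrC addKr normrZ gtr0_norm// ler_piMr// ltW.
  move: t2; rewrite -[t.2](mulKf r1) nr mul1r.
  by rewrite mulrA mulfV// mul1r.
- by rewrite mulr_ge0// invr_ge0 ltW.
Qed.

(* Successive boxes rise by their own size so as to stay in the half-space. *)
Lemma box_chain : exists2 kap : R, 0 < kap & forall u z1 (r m : R) (k : nat),
  nonneg_sol u -> 0 < r -> r <= z1.2 -> 0 < m ->
  (forall z, near_pt r z1 z -> m <= u z) ->
  forall z, near_pt (5 * (2 ^+ k * r)) (z1.1, z1.2 + 2 * r * (2 ^+ k - 1)) z ->
    0 <= z.2 -> kap ^+ k.+1 * m <= u z.
Proof.
have [kap kap0 grow] := box_growth_at; exists kap => // u z1 r m k us r0 rz1 m0 um.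
have p1 j : 1 <= 2 ^+ j :> R by rewrite exprn_ege1// ler1n.
have p0 j : 0 < 2 ^+ j * r by rewrite mulr_gt0// (lt_le_trans ltr01).
have pY j : 2 ^+ j * r <= z1.2 + 2 * r * (2 ^+ j - 1).
  have : 0 <= r * (2 ^+ j - 1) by rewrite mulr_ge0 ?(ltW r0)// subr_ge0.
  by clear -rz1; lra.
have inner : forall z, near_pt (2 ^+ k * r) (z1.1, z1.2 + 2 * r * (2 ^+ k - 1)) z ->
    kap ^+ k * m <= u z.
  elim: k => [|k IH] z [/= h1 h2].
    rewrite expr0 mul1r; apply: um; split; rewrite expr0 mul1r in h1 h2 => //.
    by rewrite subrr mulr0 addr0 in h2.
  rewrite !exprS -mulrA; rewrite exprS in h1 h2.
  have m0' : 0 < kap ^+ k * m by rewrite mulr_gt0// exprn_gt0.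
  have := p0 k; move: h2; rewrite ler_norml => /andP[h2 h3] p0k.
  (* The centre rises by twice the old radius and the new radius is twice the old one, so the new
     box stays within 4 old radii of the old centre. *)
  apply: (grow u (z1.1, z1.2 + 2 * r * (2 ^+ k - 1)) (2 ^+ k * r) (kap ^+ k * m) us (p0 k) (pY k) m0' IH z).
    split=> /=; first by clear -h1 p0k; lra.
    by rewrite ler_norml; apply/andP; split; clear -h2 h3 p0k; lra.
  by have := pY k; clear -h2 p0k; lra.
have m0' : 0 < kap ^+ k * m by rewrite mulr_gt0// exprn_gt0.
by move=> z zn z0; rewrite exprS -mulrA; apply: (grow u (z1.1, z1.2 + 2 * r * (2 ^+ k - 1)) _ _ us (p0 k) (pY k) m0' inner z).
Qed.

(** The number k of doublings from size r to unit size satisfies 2^k < 8 / r, and kap >= 2^-(q + 1).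
    Hence the geometric loss kap^k is at least (r / 8)^(q + 1), a fixed power of r. *)
Lemma far_bound : exists q : nat, exists2 kap : R, 0 < kap & forall u z1 z0 (r m : R),
  nonneg_sol u -> 0 < r <= 1 -> r <= z1.2 -> z1.2 <= 4 -> 0 < m ->
  (forall z, near_pt r z1 z -> m <= u z) ->
  `|z0.1 - z1.1| <= 4 -> 0 <= z0.2 <= 4 -> kap * r ^+ q.+1 * m <= u z0.
Proof.
have [kap kap0 chain] := box_chain.
have [q hq] : exists q : nat, (1 / 2) ^+ q.+1 <= kap.
  have [q hq] := exists_nat_gt (1 / kap); exists q.
  have q2 : q.+1%:R <= 2 ^+ q.+1 :> R by rewrite -natrX ler_nat ltnW// ltn_expl.
  rewrite expr_div_n expr1n ler_pdivrMr ?exprn_gt0// mulrC -ler_pdivrMr//.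
  exact: le_trans (ltW hq) q2.
exists q, (kap * (1 / 8) ^+ q.+1); first by rewrite mulr_gt0// exprn_gt0// divr_gt0.
move=> u z1 z0 r m us /andP[r0 r1] rz1 z14 m0 um x4 /andP[y0 y4].
have exk : exists k : nat, 4 <= 2 ^+ k * r.
  have [k hk] := exists_nat_gt (4 / r); exists k.
  rewrite -ler_pdivrMr//; apply: le_trans (ltW hk) _.
  by rewrite -natrX ler_nat ltn_expl.
(* Minimality of k yields 2^k r < 8; for k = 0 this uses r <= 1. *)
case: (ex_minnP exk) => k k4 kmin.
have k8 : 2 ^+ k * r < 8.
  case: k k4 kmin => [|k] k4 kmin; first by rewrite expr0 mul1r; clear -r1; lra.
  rewrite exprS; suff : 2 ^+ k * r < 4 by clear; lra.
  by rewrite ltNge; apply/negP => /kmin; rewrite ltnn.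
apply: le_trans (chain u z1 r m k us r0 rz1 m0 um z0 _ y0).
  rewrite ler_wpM2r ?(ltW m0)// [kap ^+ _]exprS -mulrA ler_wpM2l ?(ltW kap0)// -exprMn.
  apply: (@le_trans _ _ (((1 / 2) ^+ q.+1) ^+ k)).
    rewrite -exprM mulnC exprM lerXn2r ?nnegrE ?exprn_ge0 ?divr_ge0 ?mulr_ge0 ?divr_ge0 ?(ltW r0)//.
    rewrite expr_div_n expr1n ler_pdivlMr ?exprn_gt0//.
    by move: k8; set x := 2 ^+ k; clear; lra.
  by rewrite lerXn2r ?nnegrE ?exprn_ge0 ?divr_ge0// ltW.
have rk : 0 <= r * (2 ^+ k - 1).
  by rewrite mulr_ge0 ?(ltW r0)// subr_ge0 exprn_ege1// ler1n.
split=> /=; first by clear -x4 k4; lra.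
by rewrite ler_norml; apply/andP; split; clear -x4 k4 y0 y4 z14 rk rz1 r0; lra.
Qed.

Lemma bernoulli (eta : R) (q : nat) : 0 <= eta <= 1 -> 1 - q%:R * eta <= (1 - eta) ^+ q.
Proof.
move=> /andP[e0 e1]; elim: q => [|q IH]; first by rewrite mul0r subr0.
rewrite exprS -natr1; have e2 : 0 <= 1 - eta by rewrite subr_ge0.
apply: le_trans (ler_wpM2l e2 IH).
have := mulr_ge0 (ler0n R q) (mulr_ge0 e0 e0); clear; lra.
Qed.

(* A maximum point of [u d^q], with d the distance to the lateral and top
   boundary of the box, comes with a ball of radius comparable to d on which
   [u] at most doubles; the exponent of [far_bound] makes [u d^q] there
   controlled by the value of [u] at any other point. *)
Lemma harnack_unit : exists2 C : R, 0 < C & forall u z z0, nonneg_sol u ->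
  `|z.1| <= 1 -> 0 <= z.2 <= 1 -> `|z0.1| <= 1 -> 0 <= z0.2 <= 1 -> u z <= C * u z0.
Proof.
have [Lam [kap [rho [Lam2 kap0 /andP[rho0 rho2] spr]]]] := spread.
have [q [kp kp0 far]] := far_bound.
(* Bernoulli's inequality gives (1 - eta)^p >= 1/2. Within distance eta d(z1) of the maximum point,
   d^p loses at most half of its value, so u at most doubles. *)
pose p := q.+1; pose eta : R := 1 / (2 * p.+1%:R).
have q0 : 0 < 2 * p.+1%:R :> R by rewrite mulr_gt0.
have eta0 : 0 < eta by rewrite divr_gt0.
have etaq : p%:R * eta <= 1 / 2.
  rewrite /eta mulrA mulr1 ler_pdivrMr// -[p.+1%:R]natr1; clear; lra.
have eta2 : eta <= 1 / 2.
  rewrite /eta ler_pdivrMr// -[p.+1%:R]natr1; have := ler0n R p; clear; lra.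
have Lam0 : 0 < Lam by rewrite (lt_le_trans _ Lam2).
(* g d(z1) is the radius rho r of the ball supplied by [spread] when Lam r = eta d(z1). *)
pose g := rho * eta / Lam; have g0 : 0 < g by rewrite divr_gt0// mulr_gt0.
have D0 : 0 < kp * g ^+ p * kap by rewrite !mulr_gt0// exprn_gt0.
exists (kp * g ^+ p * kap)^-1; first by rewrite invr_gt0.
move=> u z z0 us zx /andP[zy0 zy1] z0x /andP[z0y0 z0y1].
have [usol u0] := us; have [uc _ _] := usol.
rewrite mulrC ler_pdivlMr//.
pose d (t : pt) : R := Num.min (2 - `|t.1|) (2 - t.2).
have dc : continuous d.
  move=> t; apply: (@continuous_min R pt (fun t => 2 - `|t.1|) (fun t => 2 - t.2)).
    by apply: cvgB; [exact: cvg_cst|exact: norm1_continuous].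
  by apply: cvgB; [exact: cvg_cst|exact: snd_continuous].
pose f t := u t * d t ^+ p.
have fc : continuous f.
  move=> t; apply: cvgM; first exact: uc.
  exact: (cvg_comp _ _ (dc t) (@exprn_continuous _ p _)).
pose D2 := [set t : pt | `|t.1| <= 2 /\ 0 <= t.2 <= 2].
have D2z : D2 z by split; [|rewrite zy0/=]; [clear -zx|clear -zy1]; lra.
have [z1] : exists2 t, t \in D2 & forall s, s \in D2 -> f s <= f t.
  apply: compact_EVT_max; [by exists z|exact: compact_slab|exact: continuous_subspaceT].
rewrite inE => -[z1x /andP[z1y0 z1y2]] fmax.
have {}fmax t : D2 t -> f t <= f z1 by move=> ?; apply: fmax; rewrite inE.
have dz : 1 <= d z by rewrite le_min; apply/andP; split; [clear -zx|clear -zy1]; lra.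
have uz : u z <= f z1.
  by apply: le_trans (fmax z D2z); rewrite ler_peMr ?u0// exprn_ege1.
have d10 : 0 <= d z1 by rewrite le_min !subr_ge0 z1x.
have [S0|S0] := leP (f z1) 0.
  apply: (@le_trans _ _ 0); last exact: u0.
  by rewrite pmulr_lle0// (le_trans uz).
have M0 : 0 < u z1.
  rewrite lt_neqAle u0// andbT; apply/eqP => uz10.
  by move: S0; rewrite /f -uz10 mul0r ltxx.
have d1pos : 0 < d z1 ^+ p.
  by move: S0; rewrite /f pmulr_rgt0.
have d1 : 0 < d z1.
  rewrite lt_neqAle d10 andbT; apply/eqP => d1E.
  by move: d1pos; rewrite -d1E /p expr0n ltxx.
have d12 : d z1 <= 2.
  by rewrite ge_min lerBlDr lerDl normr_ge0.
pose r := eta * d z1 / Lam; have r0 : 0 < r by rewrite divr_gt0// mulr_gt0.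
have rE : Lam * r = eta * d z1 by rewrite /r mulrC divfK// gt_eqF.
have ed1 : eta * d z1 <= 1.
  by apply: le_trans (ler_pM (ltW eta0) d10 eta2 d12) _; clear -eta2; lra.
have [t [t1 t2] t0|z2 [[z2x z2y] z2r z2M]] := spr u z1 r (u z1) us z1y0 r0 M0 (lexx _).
  have dt : (1 - eta) * d z1 <= d t.
    rewrite rE in t1 t2; move: t2; rewrite ler_norml => /andP[_ t2].
    have nt : `|t.1| <= `|z1.1| + eta * d z1.
      by rewrite -lerBlDl; apply: le_trans t1; exact: lerB_dist.
    have h1 : d z1 <= 2 - `|z1.1| by rewrite ge_min lexx.
    have h2 : d z1 <= 2 - z1.2 by rewrite ge_min lexx orbT.
    by rewrite le_min; apply/andP; split; [clear -nt h1|clear -t2 h2]; lra.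
  have e1 : 0 < 1 - eta by clear -eta2; lra.
  have dt0 : 0 < d t by apply: lt_le_trans dt; rewrite mulr_gt0.
  have D2t : D2 t.
    move: dt0; rewrite lt_min !subr_gt0 => /andP[h1 h2].
    by split; [exact: ltW|rewrite t0 ltW].
  have half : d z1 ^+ p / 2 <= d t ^+ p.
    apply: (@le_trans _ _ (((1 - eta) * d z1) ^+ p)); last first.
      by rewrite lerXn2r ?nnegrE ?mulr_ge0 ?(ltW e1) ?(ltW dt0).
    rewrite exprMn mulrC ler_wpM2r ?(ltW d1pos)//.
    apply: le_trans (bernoulli p _); last first.
      by rewrite (ltW eta0)/=; clear -eta2; lra.
    by clear -etaq; lra.
  rewrite -(ler_pM2r d1pos); apply: le_trans (_ : 2 * (u t * d t ^+ p) <= _).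
    have := ler_wpM2l (u0 t t0) half; clear; lra.
  by have := fmax t D2t; rewrite /f; clear; lra.
have rho1 : rho * r <= r by rewrite ler_piMl ?(ltW r0)//; clear -rho2; lra.
have Lr : 2 * r <= Lam * r by rewrite ler_wpM2r// ltW.
have := far u z2 z0 (rho * r) (kap * u z1) us.
rewrite mulr_gt0//= z2r mulr_gt0// rE in z2x z2y *.
move=> /(_ _ isT _ isT z2M) H.
have {}H : kp * (rho * r) ^+ p * (kap * u z1) <= u z0.
  apply: H; last by rewrite z0y0/=; clear -z0y1; lra.
  - by clear -rho1 Lr rE ed1; lra.
  - by move: z2y; rewrite ler_norml => /andP[_ h]; clear -h ed1 z1y2; lra.
  - have := lerB_dist z2.1 z1.1; have := ler_normD z0.1 (- z2.1); rewrite normrN.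
    by clear -z2x ed1 z1x z0x; lra.
(* The loss (g d(z1))^p from [far_bound] carries the same power of d(z1) as the weight in [f], so
   the final constant does not depend on d(z1). *)
apply: le_trans H; rewrite (_ : rho * r = g * d z1); last by rewrite /g /r; ring.
apply: (le_trans (ler_wpM2r (ltW D0) uz)); rewrite /f -mulrA.
have -> : (g * d z1) ^+ p = g ^+ p * d z1 ^+ p by rewrite exprMn.
by rewrite le_eqVlt; apply/orP; left; apply/eqP; ring.
Qed.

(** The class of nonnegative solutions is invariant under dilations, so any two points can be
    brought into the unit box without changing the constant. *)
Lemma harnack : exists2 C : R, 0 < C & forall u z z0, nonneg_sol u ->
  0 <= z.2 -> 0 <= z0.2 -> u z <= C * u z0.
Proof.
have [C C0 H] := harnack_unit; exists C => // u z z0 us z20 z020.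
pose r : R := 1 + (`|z.1| + `|z0.1|) + (z.2 + z0.2).
have n1 := normr_ge0 z.1; have n2 := normr_ge0 z0.1.
have r0 : 0 < r by rewrite /r; clear -n1 n2 z20 z020; lra.
have r1 : r != 0 by rewrite gt_eqF.
have := H _ (r^-1 *: (z.1 - 0), r^-1 * z.2) (r^-1 *: (z0.1 - 0), r^-1 * z0.2)
  (nonneg_sol_dilate 0 r0 us).
rewrite !dilateK// /= !normr_dilate// !subr0 !mul1r ![r^-1 * _]mulrC.
rewrite !ler_pdivrMr// !mul1r !divr_ge0 ?(ltW r0)//=; apply; rewrite /r;
  by clear -n1 n2 z20 z020; lra.
Qed.

Lemma liouville_lbound u : sol L u -> has_lbound (u @` closed_half_space R N) ->
  exists k : R, forall z, closed_half_space R N z -> u z = k.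
Proof.
move=> us ulb; have [C C0 H] := harnack.
pose A := u @` closed_half_space R N.
have Ai : has_inf A.
  by split=> //; exists (u (0, 0)); exists (0, 0) => //=; rewrite /closed_half_space /= lexx.
pose k := inf A; exists k => z zH.
have kle t : 0 <= t.2 -> k <= u t by move=> t0; apply: ge_inf => //; exists t.
have vs : nonneg_sol (fun z => 1 * u z + - k).
  by split=> [|t t0]; [exact: sol_affine|rewrite mul1r subr_ge0 kle].
apply/eqP; rewrite eq_le kle// andbT leNgt; apply/negP => ukz.
(* With this accuracy, C (u z0 - k) is less than half of u z - k, against the Harnack inequality. *)
have e0 : 0 < (u z - k) / (2 * C) by rewrite divr_gt0 ?subr_gt0// mulr_gt0.
have [_ [z0 z0H <-] hz0] := inf_adherent e0 Ai.
have := H _ z z0 vs zH z0H; rewrite !mul1r.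
have : C * (u z0 - k) < C * ((u z - k) / (2 * C)) by rewrite ltr_pM2l// ltrBlDl.
have -> : C * ((u z - k) / (2 * C)) = (u z - k) / 2 by field; rewrite gt_eqF.
by clear -ukz; lra.
Qed.

Theorem liouville u : sol L u ->
  has_lbound (u @` closed_half_space R N) \/ has_ubound (u @` closed_half_space R N) ->
  exists k : R, forall z, closed_half_space R N z -> u z = k.
Proof.
move=> us [|[M uM]]; first exact: liouville_lbound.
have us' := sol_affine (-1) 0 us.
have [|k hk] := liouville_lbound us'.
  exists (- M) => _ [z zH <-]; rewrite addr0 mulN1r lerN2; apply: uM; by exists z.
by exists (- k) => z /hk <-; rewrite addr0 mulN1r opprK.
Qed.

End Harnack.

(** * From C2 solutions to second-order expansions *)

Section FromC2.
Context {R : realType} {N : nat}.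
Local Notation pt := ('rV[R]_N * R)%type.
Implicit Types (u v : pt -> R) (z : pt).

(** Even reflection in y, which provides the function continuous on the whole space that [sol] asks
    for. It also serves for the continuous extensions of derivatives; only continuity is carried
    across y = 0. *)
Definition fold_up u : pt -> R := fun z => u (z.1, `|z.2|).

Lemma fold_up_continuous u :
  {within closed_half_space R N, continuous u} -> continuous (fold_up u).
Proof.
move=> /subspace_continuousP uc z; pose q (t : pt) : pt := (t.1, `|t.2|).
have qz : closed_half_space R N (q z) by rewrite /closed_half_space /=.
have q2 : `|t.2| @[t --> z] --> `|z.2|.
  exact: (cvg_comp _ _ (@snd_continuous R N z) (@norm_continuous _ _ z.2)).
have qc : q @ z --> q z by exact: (cvg_pair (@fst_continuous R N z) q2).
have qw : q @ z --> within (closed_half_space R N) (nbhs (q z)).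
  move=> A wA.
  have h1 : nbhs (q z) (fun t => closed_half_space R N t -> A t) by exact: wA.
  have h2 : nbhs z (fun t => closed_half_space R N (q t) -> A (q t)) := qc _ h1.
  suff : nbhs z (fun t => A (q t)) by [].
  apply: filterS h2 => t; apply.
  by rewrite /closed_half_space /=.
exact: (cvg_comp _ _ qw (uc _ qz)).
Qed.

Lemma fold_upE u z : 0 <= z.2 -> fold_up u z = u z.
Proof. by move=> z0; rewrite /fold_up ger0_norm// -surjective_pairing. Qed.

Lemma continuous_square (F : pt -> R) z (d : 'rV[R]_N) (e : R) : continuous F ->
  0 < e -> exists2 r, 0 < r & forall s t : R, `|s| < r -> `|t| < r ->
    `|F (z.1 + s *: d, z.2 + t) - F z| <= e.
Proof.
move=> Fc e0; pose m (p : R * R) : pt := (z.1 + p.1 *: d, z.2 + p.2).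
have f1 : p.1 @[p --> ((0, 0) : R * R)] --> (0 : R) by exact: cvg_fst.
have f2 : p.2 @[p --> ((0, 0) : R * R)] --> (0 : R) by exact: cvg_snd.
have m1 : z.1 + p.1 *: d @[p --> ((0, 0) : R * R)] --> z.1.
  rewrite -[X in _ --> X]addr0; apply: cvgD; first exact: cvg_cst.
  by rewrite -[X in _ --> X](scale0r d); apply: cvgZr_tmp.
have m2 : z.2 + p.2 @[p --> ((0, 0) : R * R)] --> z.2.
  by rewrite -[X in _ --> X]addr0; apply: cvgD; first exact: cvg_cst.
have mc : m @ ((0, 0) : R * R) --> z.
  by rewrite [X in _ --> X]surjective_pairing; exact: (cvg_pair m1 m2).
have /cvgrPdist_le/(_ _ e0) := cvg_comp _ _ mc (Fc z).
move=> /nbhs_ballP[r /= r0 Hr]; exists r => // s t sr tr.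
rewrite distrC; apply: (Hr (s, t)).
by split; rewrite /ball /= sub0r normrN.
Qed.

Lemma is_derive_line v z (k : option 'I_N) (s : R) :
  derivable v (step z (basis_vec R k) s) (basis_vec R k) ->
  is_derive s 1 (fun t => v (step z (basis_vec R k) t))
    (partial k v (step z (basis_vec R k) s)).
Proof.
move=> vd; set b := basis_vec R k in vd *.
have E : (fun h : R => h^-1 *: (((fun t => v (step z b t)) \o shift s) (h *: (1 : R))
      - v (step z b s)))
    = (fun h => h^-1 *: ((v \o shift (step z b s)) (h *: b) - v (step z b s))).
  apply/funext => h /=; congr (_ *: (v _ - _)).
  rewrite /step /= [h *: 1]mulr1; congr pair.
    by rewrite /= scalerDl addrCA.
  by rewrite /= mulrDl addrCA.
apply: DeriveDef; first by rewrite /derivable E; exact: vd.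
by rewrite /partial /derive E.
Qed.

(** The segment in the direction e_i + eta e_y is replaced by a horizontal leg followed by a
    vertical one, with a Taylor expansion on each. The vertical slope at the corner is itself
    expanded along e_i, which produces the mixed derivative in the order used by [operator_L]. *)
Lemma jet2_cross u z (i : 'I_N) (eta : R) :
  C2_closed_half_space u -> half_space R N z ->
  jet2 (fun t => fold_up u (z.1 + t *: delta_mx ord0 i, z.2 + t * eta)) (u z)
    (partial (Some i) u z + eta * partial None u z)
    (partial (Some i) (partial (Some i) u) z
     + 2 * eta * partial (Some i) (partial None u) z
     + eta ^+ 2 * partial None (partial None u) z).
Proof.
move=> [_ C1 C2] zH.
have sq k l e : 0 < e -> exists2 r, 0 < r & forall s t : R, `|s| < r -> `|t| < r ->
    0 < z.2 + t /\ `|partial l (partial k u) (z.1 + s *: delta_mx ord0 i, z.2 + t)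
      - partial l (partial k u) z| <= e.
  move=> e0; have [_ [h hc hE]] := C2 k l.
  have [r r0 Hr] := continuous_square z (delta_mx ord0 i) (fold_up_continuous hc) e0.
  exists (Num.min r z.2); first by rewrite lt_min r0.
  move=> s t; rewrite !lt_min => /andP[sr _] /andP[tr ty].
  have zt : 0 < z.2 + t by move: ty; rewrite ltr_norml => /andP[h1 _]; clear -h1; lra.
  split=> //; have := Hr s t sr tr; rewrite !fold_upE ?(ltW zt) ?(ltW zH)//.
  by rewrite !hE.
have step1 y s : step (z.1, y) (basis_vec R (Some i)) s = (z.1 + s *: delta_mx ord0 i, y).
  by rewrite /step /= mulr0 addr0.
have step2 x s : step (x, z.2) (basis_vec R (@None 'I_N)) s = (x, z.2 + s).
  by rewrite /step /= scaler0 addr0 mulr1.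
have d1 v : (forall t, half_space R N t -> derivable v t (basis_vec R (Some i))) ->
    forall s : R, is_derive s 1 (fun t => v (z.1 + t *: delta_mx ord0 i, z.2))
      (partial (Some i) v (z.1 + s *: delta_mx ord0 i, z.2)).
  move=> vd s; have := @is_derive_line v (z.1, z.2) (Some i) s.
  rewrite step1; under eq_fun do rewrite step1; apply; exact: vd.
have d2 v x s : (forall t, half_space R N t -> derivable v t (basis_vec R None)) ->
    0 < z.2 + s -> is_derive s 1 (fun t => v (x, z.2 + t))
      (partial None v (x, z.2 + s)).
  move=> vd zs; have := @is_derive_line v (x, z.2) None s.
  rewrite step2; under eq_fun do rewrite step2; apply; exact: vd.
(* The errors of the horizontal leg, of the corner slope and of the vertical leg add up to e (1 +
   |eta| + eta^2) t^2. *)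
pose K := 1 + `|eta| + eta ^+ 2.
have K0 : 0 < K by rewrite /K -addrA ltr_pwDl// addr_ge0// sqr_ge0.
apply: jet2_eps => [|e' e'0].
  by rewrite scale0r mul0r !addr0 fold_upE ?(ltW zH)// -surjective_pairing.
pose e := e' / K; have e0 : 0 < e by rewrite divr_gt0.
have [r1 r10 H1] := sq (Some i) (Some i) e e0.
have [r2 r20 H2] := sq None (Some i) e e0.
have [r3 r30 H3] := sq None None e e0.
pose r := Num.min (Num.min r1 r2) r3.
have r0 : 0 < r by rewrite !lt_min r10 r20.
have eta1 : 0 < 1 + `|eta| by rewrite ltr_pwDl.
exists (r / (1 + `|eta|)); first exact: divr_gt0.
move=> t; rewrite ltr_pdivlMr// => tr.
have t1 : `|t| < r.
  apply: le_lt_trans tr; have := mulr_ge0 (normr_ge0 t) (normr_ge0 eta); clear; lra.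
have t2 : `|t * eta| < r.
  rewrite normrM; apply: le_lt_trans tr; have := normr_ge0 t; clear; lra.
have [[s1 s2] s3] : (`|t| < r1 /\ `|t| < r2) /\ `|t| < r3.
  by move: t1; rewrite !lt_min => /andP[/andP[? ?] ?].
have s4 : `|t * eta| < r3 by move: t2; rewrite !lt_min => /andP[_].
have n0 : `|0 : R| < r1 /\ `|0 : R| < r2 by rewrite normr0.
pose x := z.1 + t *: delta_mx ord0 i.
have z0 : (z.1 + 0 *: delta_mx ord0 i, z.2) = z.
  by rewrite scale0r addr0 -surjective_pairing.
set ui := partial (Some i) u z; set uy := partial None u z.
set uii := partial (Some i) (partial (Some i) u) z.
set uiy := partial (Some i) (partial None u) z.
set uyy := partial None (partial None u) z.
have A1 : `|u (x, z.2) - (u z + ui * t + uii / 2 * t ^+ 2)| <= e * t ^+ 2.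
  pose f1 (s : R) := partial (Some i) u (z.1 + s *: delta_mx ord0 i, z.2).
  have fd (s : R) : `|s| < r1 -> is_derive s 1 (fun t => u (z.1 + t *: delta_mx ord0 i, z.2)) (f1 s) :=
    fun=> d1 _ (proj1 (C1 (Some i))) s.
  have f1d (s : R) : `|s| < r1 -> is_derive s 1 f1 _ :=
    fun=> d1 _ (proj1 (C2 (Some i) (Some i))) s.
  have f2b (s : R) : `|s| < r1 ->
      `|partial (Some i) (partial (Some i) u) (z.1 + s *: delta_mx ord0 i, z.2) - uii| <= e.
    by move=> sr; have [_] := H1 s 0 sr (proj1 n0); rewrite (addr0 z.2).
  by have := taylor2_bound fd f1d f2b s1; rewrite /f1 z0.
have A2 : `|partial None u (x, z.2) - (uy + uiy * t)| <= e * `|t|.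
  pose f2 (s : R) := partial (Some i) (partial None u) (z.1 + s *: delta_mx ord0 i, z.2).
  have f1d (s : R) : `|s| < r2 -> is_derive s 1 _ (f2 s) :=
    fun=> d1 _ (proj1 (C2 None (Some i))) s.
  have [s st] := mvt0 f1d s2; rewrite z0 -/x -/uy => E.
  have aux (P Q F G : R) : P - Q = F * t -> P - (Q + G * t) = (F - G) * t.
    by move=> PQ; rewrite opprD addrA PQ mulrBl.
  rewrite (aux _ _ _ _ E) normrM ler_wpM2r//.
  by have [_] := H2 s 0 (le_lt_trans st s2) (proj2 n0); rewrite (addr0 z.2).
have A3 : `|u (x, z.2 + t * eta) - (u (x, z.2) + partial None u (x, z.2) * (t * eta)
    + uyy / 2 * (t * eta) ^+ 2)| <= e * (t * eta) ^+ 2.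
  pose f1 (s : R) := partial None u (x, z.2 + s).
  have pos (s : R) : `|s| < r3 -> 0 < z.2 + s by move=> sr; have [] := H3 t s s3 sr.
  have fd (s : R) : `|s| < r3 -> is_derive s 1 (fun t => u (x, z.2 + t)) (f1 s).
    by move=> sr; exact: (d2 _ _ _ (proj1 (C1 None))) (pos s sr).
  have f1d (s : R) : `|s| < r3 ->
      is_derive s 1 f1 (partial None (partial None u) (x, z.2 + s)).
    by move=> sr; exact: (d2 _ _ _ (proj1 (C2 None None))) (pos s sr).
  have f2b (s : R) : `|s| < r3 -> `|partial None (partial None u) (x, z.2 + s) - uyy| <= e.
    by move=> sr; have [_] := H3 t s s3 sr.
  by have := taylor2_bound fd f1d f2b s4; rewrite /f1 (addr0 z.2).
have [zt _] := H3 t (t * eta) s3 s4.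
rewrite fold_upE ?(ltW zt)//= -/x.
move: A1 A2 A3; move: (u (x, z.2 + _)) (u (x, z.2)) (partial None u (x, z.2)) (u z).
move: {H1 H2 H3 zt} ui uy uii uiy uyy => ui uy uii uiy uyy X X0 Y0 u0.
set a1 := X0 - _; set a2 := Y0 - _; set a3 := X - _ => A1 A2 A3.
have -> : X - (u0 + (ui + eta * uy) * t
    + (uii + 2 * eta * uiy + eta ^+ 2 * uyy) / 2 * t ^+ 2)
  = a1 + a2 * (t * eta) + a3 by rewrite /a1 /a2 /a3; field.
apply: le_trans (ler_normD _ _) _; apply: le_trans (lerD (ler_normD _ _) A3) _.
have A2' : `|a2 * (t * eta)| <= e * t ^+ 2 * `|eta|.
  rewrite normrM (normrM t) -[t ^+ 2]real_normK ?num_real// expr2 !mulrA.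
  by rewrite ler_wpM2r// ler_wpM2r.
have -> : e' * t ^+ 2 = e * t ^+ 2 + e * t ^+ 2 * `|eta| + e * (t * eta) ^+ 2.
  rewrite (_ : e' = e * K); last by rewrite /e divfK// gt_eqF.
  by rewrite /K; ring.
by rewrite lerD2r lerD.
Qed.

Lemma jet2_vertical u z : C2_closed_half_space u -> half_space R N z ->
  jet2 (fun t => fold_up u (z.1, z.2 + t)) (u z) (partial None u z)
    (partial None (partial None u) z).
Proof.
move=> [_ C1 C2] zH.
have step2 s : step z (basis_vec R (@None 'I_N)) s = (z.1, z.2 + s).
  by rewrite /step /= scaler0 addr0 mulr1.
have d2 v s : (forall t, half_space R N t -> derivable v t (basis_vec R None)) ->
    0 < z.2 + s -> is_derive s 1 (fun t => v (z.1, z.2 + t))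
      (partial None v (z.1, z.2 + s)).
  move=> vd zs; have := @is_derive_line v z None s.
  rewrite step2; under eq_fun do rewrite step2; apply; exact: vd.
apply: jet2_eps => [|e e0]; first by rewrite addr0 fold_upE ?(ltW zH)// -surjective_pairing.
have [_ [h hc hE]] := C2 None None.
have [r r0 Hr] := continuous_square z 0 (fold_up_continuous hc) e0.
exists (Num.min r z.2); first by rewrite lt_min r0.
have pos t : `|t| < z.2 -> 0 < z.2 + t.
  by rewrite ltr_norml => /andP[h1 _]; clear -h1; lra.
move=> t; rewrite lt_min => /andP[tr tz].
pose f1 (s : R) := partial None u (z.1, z.2 + s).
have fd (s : R) : `|s| < Num.min r z.2 ->
    is_derive s 1 (fun t => u (z.1, z.2 + t)) (f1 s).
  by rewrite lt_min => /andP[_ sz]; exact: (d2 _ _ (proj1 (C1 None))) (pos s sz).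
have f1d (s : R) : `|s| < Num.min r z.2 ->
    is_derive s 1 f1 (partial None (partial None u) (z.1, z.2 + s)).
  by rewrite lt_min => /andP[_ sz]; exact: (d2 _ _ (proj1 (C2 None None))) (pos s sz).
have f2b (s : R) : `|s| < Num.min r z.2 ->
    `|partial None (partial None u) (z.1, z.2 + s) - partial None (partial None u) z| <= e.
  rewrite lt_min => /andP[sr sz].
  have := Hr 0 s; rewrite normr0 => /(_ r0 sr); rewrite scale0r (addr0 z.1).
  by rewrite !fold_upE ?(ltW zH) ?(ltW (pos s sz))// !hE// /half_space /= pos.
have trz : `|t| < Num.min r z.2 by rewrite lt_min tr.
have := taylor2_bound fd f1d f2b trz.
by rewrite /f1 (addr0 z.2) -surjective_pairing fold_upE /= ?(ltW (pos t tz)).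
Qed.

Lemma near_right_bounded (F : pt -> R) (x : 'rV[R]_N) :
  continuous_up_to_boundary F ->
  exists M : R, exists2 r, 0 < r & forall y, 0 < y < r -> `|F (x, y)| <= M.
Proof.
move=> [h hc hE].
have [r r0 Hr] := continuous_square (x, 0) 0 (fold_up_continuous hc) (@ltr01 R).
exists (`|fold_up h (x, 0)| + 1), r => // y /andP[y0 yr].
have yH : half_space R N (x, y) by [].
rewrite -hE// -(fold_upE h (z := (x, y)) (ltW y0)).
have := Hr 0 y; rewrite normr0 gtr0_norm// => /(_ r0 yr).
rewrite scale0r addr0 add0r => H1.
rewrite -[X in `|X|](subrK (fold_up h (x, 0))) addrC.
by apply: le_trans (ler_normD _ _) _; rewrite lerD2l.
Qed.

Lemma near_right_bounded_sum (F : 'I_N -> pt -> R) (x : 'rV[R]_N) (s : seq 'I_N) :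
  (forall i, continuous_up_to_boundary (F i)) -> forall b : 'I_N -> R,
  exists M : R, exists2 r, 0 < r &
    forall y, 0 < y < r -> `|\sum_(i <- s) b i * F i (x, y)| <= M.
Proof.
move=> Fc b; elim: s => [|i s [M [r r0 Hr]]].
  by exists 0, 1 => // y _; rewrite big_nil normr0.
have [M' [r' r'0 Hr']] := near_right_bounded x (Fc i).
exists (`|b i| * M' + M), (Num.min r r'); first by rewrite lt_min r0.
move=> y; rewrite lt_min => /andP[y0 /andP[yr yr']].
rewrite big_cons; apply: le_trans (ler_normD _ _) _; apply: lerD.
  by rewrite normrM ler_wpM2l// Hr'// y0.
by rewrite Hr// y0.
Qed.

(* For c > 0 this is forced by the equation: [c / y * u_y] is bounded. *)
Lemma vertical_derivative_small (c : R) (a : 'rV[R]_N) u (x : 'rV[R]_N) (e : R) :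
  0 < c + 1 -> C2_closed_half_space u ->
  (forall z, half_space R N z -> operator_L c a u z = 0) ->
  (y `^ c * partial None u (x, y) @[y --> 0^'+] --> (0 : R)) -> 0 < e ->
  exists2 r, 0 < r & forall y, 0 < y < r ->
    `|partial None u (x, y)| <= e * y `^ (- Num.min c 0).
Proof.
move=> hc [_ C1 C2] hL hN e0; have [c0|c0] := leP c 0.
  (* For c <= 0 the claim is the Neumann limit divided by y^c. *)
  have /cvgrPdist_le/(_ _ e0)[r /= r0 Hr] := hN.
  exists r => // y /andP[y0 yr]; have := Hr y; rewrite /= !sub0r !normrN.
  rewrite (gtr0_norm y0) => /(_ yr y0); rewrite normrM (ger0_norm (powR_ge0 _ _)).
  by rewrite powRN mulrC ler_pdivlMr ?powR_gt0.
have [M1 [r1 r10 H1]] := near_right_bounded_sum x (index_enum _)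
  (fun i => proj2 (C2 (Some i) (Some i))) (fun=> 1).
have [M2 [r2 r20 H2]] := near_right_bounded_sum x (index_enum _)
  (fun i => proj2 (C2 None (Some i))) (fun i => a ord0 i).
have [M3 [r3 r30 H3]] := near_right_bounded x (proj2 (C2 None None)).
pose M := `|M1| + 2 * `|M2| + `|M3| + 1.
have M0 : 0 < M by rewrite ltr_wpDl// !addr_ge0// mulr_ge0.
(* The equation gives c |u_y| <= y M, and y M <= e c for y < r4. *)
pose r4 := e * c / M; have r40 : 0 < r4 by rewrite divr_gt0// mulr_gt0.
exists (Num.min (Num.min r1 r2) (Num.min r3 r4)); first by rewrite !lt_min r10 r20 r30.
move=> y; rewrite !lt_min => /andP[y0 /andP[/andP[y1 y2] /andP[y3 y4]]].
rewrite oppr0 powRr0 mulr1.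
have := hL (x, y) y0; rewrite /operator_L /= => E.
have {}H1 := H1 y; rewrite y0 y1 in H1; have {}H1 := H1 isT.
have {}H2 := H2 y; rewrite y0 y2 in H2; have {}H2 := H2 isT.
have {}H3 := H3 y; rewrite y0 y3 in H3; have {}H3 := H3 isT.
rewrite (eq_bigr (fun i => partial (Some i) (partial (Some i) u) (x, y))) in H1; last first.
  by move=> i _; rewrite mul1r.
move: E H1 H2 H3; set s1 := \sum_(i < N) _; set s2 := \sum_(i < N) _.
move: (partial None (partial None u) _) (partial None u _) s1 s2.
move=> uyy uy s1 s2 E H1 H2 H3.
have cy : c * uy = - (y * (s1 + 2 * s2 + uyy)).
  have : y * (s1 + 2 * s2 + uyy + c / y * uy) = 0 by rewrite E mulr0.
  have -> : y * (s1 + 2 * s2 + uyy + c / y * uy) = y * (s1 + 2 * s2 + uyy) + c * uy.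
    by field; rewrite gt_eqF.
  by move/eqP; rewrite addr_eq0 => /eqP ->; rewrite opprK.
have sM : `|s1 + 2 * s2 + uyy| <= M.
  apply: le_trans (ler_normD _ _) _; apply: le_trans (lerD (ler_normD _ _) H3) _.
  rewrite normrM (ger0_norm (ler0n _ 2)).
  have := ler_norm M1; have := ler_norm M2; have := ler_norm M3.
  rewrite /M; move: H1 H2; clear; lra.
have : c * `|uy| <= y * M.
  rewrite -[c in leLHS](gtr0_norm c0) -normrM cy normrN normrM (gtr0_norm y0).
  by rewrite ler_wpM2l// ltW.
rewrite mulrC -ler_pdivlMr// => /le_trans; apply.
by rewrite ler_pdivrMr// -ler_pdivlMr// ltW.
Qed.

End FromC2.

(** * Decomposition of the operator and the folded solution *)

Section Reduction.
Context {R : realType} {N : nat}.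
Local Notation pt := ('rV[R]_N * R)%type.
Implicit Types (u : pt -> R).

(* Writes the principal part as a positive combination of squares of fixed
   directions among which all the e_i occur. *)
Lemma exists_coefs (c : R) (a : 'rV[R]_N) : 0 < c + 1 -> euclidean_norm a < 1 ->
  exists L : coefs R N, drift L = c /\
    forall i, (1 - hweight L) * tilt L i = a ord0 i.
Proof.
move=> hc; rewrite /euclidean_norm; set s := \sum_(i < N) _ => ha.
have s0 : 0 <= s by apply: sumr_ge0 => i _; exact: sqr_ge0.
have s1 : s < 1.
  by rewrite -(sqr_sqrtr s0) -[ltRHS](expr1n _ 2) ltrXn2r ?nnegrE ?sqrtr_ge0.
(* Any positive k below 1 - |a|^2 makes the vertical weight 1 - |a|^2 / (1 - k) positive; the
   midpoint is taken. *)
pose k := (1 - s) / 2; have k0 : 0 < k by rewrite /k; lra.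
have k1 : k < 1 by rewrite /k; lra.
have kn0 : 1 - k != 0 by rewrite subr_eq0 gt_eqF.
have v0 : 0 < 1 - s / (1 - k).
  by rewrite subr_gt0 ltr_pdivrMr ?subr_gt0// mul1r /k; lra.
have ws : 1 - s / (1 - k) + (1 - k) * (\sum_(i < N) (a ord0 i / (1 - k)) ^+ 2) = 1.
  under eq_bigr do rewrite exprMn.
  by rewrite -mulr_suml -/s; field.
exists (Coefs hc k0 k1 v0 ws); split=> //= i.
by rewrite mulrC divfK.
Qed.

Lemma sol_fold_up (L : coefs R N) u :
  C2_closed_half_space u ->
  (forall z, half_space R N z ->
    operator_L (drift L) (\row_i ((1 - hweight L) * tilt L i)) u z = 0) ->
  (forall x : 'rV[R]_N,
    y `^ drift L * partial None u (x, y) @[y --> 0^'+] --> (0 : R)) ->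
  sol L (fold_up u).
Proof.
move=> uC2 hL hN; have [uc C1 _] := uC2; split; first exact: fold_up_continuous.
- move=> z z0.
  exists (fun k => (if k is Some (i, _) then partial (Some i) u z else 0)
    + slope L k * partial None u z).
  exists (fun k => (if k is Some (i, _) then partial (Some i) (partial (Some i) u) z
      + 2 * slope L k * partial (Some i) (partial None u) z else 0)
    + slope L k ^+ 2 * partial None (partial None u) z).
  split.
    rewrite /jets fold_upE ?(ltW z0)// => -[[i b]|].
      exact: jet2_cross.
    apply: (jet2_ext (f := fun t => fold_up u (z.1, z.2 + t))) => [t|].
      by rewrite /step /= scaler0 addr0 mulr1.
    by apply: (jet2_eq (jet2_vertical uC2 z0)) => //=; ring.
  rewrite -[RHS](hL z z0) /Lop /operator_L sum_weight /=.
  congr (_ + _); last by rewrite add0r mul1r.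
  set uyy := partial None (partial None u) z.
  (* The unit coefficient of D_yy is shared between e_y and the tilted directions, so that the rest
     can be matched coordinate by coordinate. *)
  have E : uyy = vweight L * uyy + (1 - hweight L) * (\sum_(i < N) tilt L i ^+ 2) * uyy.
    by rewrite -mulrDl weight_sum mul1r.
  rewrite [X in _ = _ + X]E [RHS]addrCA; congr (_ + _).
    by rewrite expr1n add0r mul1r.
  have alg (p q : 'I_N -> R) (w : R) : \sum_(i < N) p i
      + 2 * (\sum_(i < N) (\row_i ((1 - hweight L) * tilt L i)) ord0 i * q i)
      + (1 - hweight L) * (\sum_(i < N) tilt L i ^+ 2) * w
    = \sum_(i < N) (hweight L * p i
        + (1 - hweight L) * (p i + 2 * tilt L i * q i + tilt L i ^+ 2 * w)).
    rewrite mulr_sumr (mulrAC _ _ w) mulr_sumr -!big_split /=.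
    by apply: eq_bigr => i _; rewrite mxE; ring.
  rewrite alg; apply: eq_bigr => i _; congr (_ * _ + _).
  by rewrite mulr0 mul0r addr0 expr0n /= mul0r addr0.
- move=> x e e0.
  have [r r0 Hr] := vertical_derivative_small (drift_gt L) uC2 hL (hN x) e0.
  exists r => // y /andP[y0 yr].
  have ud s : s \in `]0, y[ ->
      is_derive s 1 (fun t => u (x, t)) (partial None u (x, s)).
    rewrite in_itv/= => /andP[s0 _].
    have stepE t : step ((x, 0) : pt) (basis_vec R (@None 'I_N)) t = (x, t).
      by rewrite /step /= scaler0 addr0 mulr1 add0r.
    have := @is_derive_line R N u (x, 0) None s.
    rewrite stepE; under eq_fun do rewrite stepE.
    by apply; apply: (proj1 (C1 None)).
  have fc : continuous (fun t : R => fold_up u (x, t)).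
    move=> t; have cx : (fun=> x : 'rV[R]_N) @ t --> x by exact: cst_continuous.
    have ct : (fun q : R => q) @ t --> t by exact: cvg_id.
    have c1 : (fun q => (x, q) : pt) @ t --> ((x, t) : pt) by exact: (cvg_pair cx ct).
    have c2 := @fold_up_continuous R N u uc (x, t).
    exact: (cvg_comp _ _ c1 c2).
  have cc : {within `[0, y], continuous (fun t => u (x, t))}.
    apply: (@subspace_eq_continuous _ _ _ (fun t => fold_up u (x, t))).
      move=> t; rewrite inE /= in_itv/= => /andP[t0 _].
      by rewrite fold_upE.
    exact: continuous_subspaceT.
  (* The increment is y u_y(x, s) with 0 < s < y. As -min(c, 0) >= 0, the bound at s is at most the
     one at y, and the product with y is e y^p. *)
  have [s] := MVT y0 ud cc; rewrite in_itv/= => /andP[s0 sy] E.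
  rewrite !fold_upE ?(ltW y0)// E subr0 normrM (gtr0_norm y0).
  have p0 : 0 <= - Num.min (drift L) 0 by rewrite oppr_ge0 ge_min lexx orbT.
  have := Hr s; rewrite s0 (lt_trans sy yr) => /(_ isT) H.
  have -> : y `^ edge_exp L = y `^ (- Num.min (drift L) 0) * y.
    have e1 : edge_exp L - 1 = - Num.min (drift L) 0 by rewrite /edge_exp; ring.
    rewrite -e1 mulrC mulr_powRB1 ?(ltW y0)//.
    by rewrite (lt_le_trans ltr01)// edge_exp_ge1.
  rewrite mulrA ler_wpM2r ?(ltW y0)//; apply: le_trans H _.
  rewrite ler_wpM2l ?(ltW e0)//; apply: ge0_ler_powR => //.
  - by rewrite nnegrE ltW.
  - by rewrite nnegrE ltW.
  - exact: ltW.
Qed.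

End Reduction.

Theorem corollary7p4 (R : realType) (N : nat) (c : R) (a : 'rV[R]_N)
    (hc : 0 < c + 1) (ha : euclidean_norm a < 1)
    (u : 'rV[R]_N * R -> R)
    (hu : C2_closed_half_space u)
    (hL : forall z, half_space R N z -> operator_L c a u z = 0)
    (hN : forall x : 'rV[R]_N,
        y `^ c * partial None u (x, y) @[y --> 0^'+] --> (0 : R))
    (hb : has_lbound (u @` closed_half_space R N) \/
          has_ubound (u @` closed_half_space R N)) :
  exists k : R, forall z, closed_half_space R N z -> u z = k.
Proof.
have [L [Lc La]] := exists_coefs hc ha.
have aE : \row_i ((1 - hweight L) * tilt L i) = a by apply/rowP => i; rewrite mxE La.
have us : sol L (fold_up u) by apply: sol_fold_up => //; rewrite Lc ?aE.
have foldE : fold_up u @` closed_half_space R N = u @` closed_half_space R N.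
  apply/seteqP; split=> _ [z z0 <-]; exists z => //; last exact: fold_upE.
  by rewrite fold_upE.
have [|k uk] := liouville us; first by rewrite foldE.
by exists k => z z0; rewrite -(uk z z0) fold_upE.
Qed.
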